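(* Consider Case 2 of the problem described in the context (latent heat $\ell$ unknown; $k,\rho,c>0$, $T_m$, $T_0>T_m$, $q_0>0$ given), whose solution for $0<\alpha<1$, under the hypothesis $\frac{\sqrt{\rho ck}(T_0-T_m)}{q_0\Gamma(1-\alpha/2)}<1$, is $\ell_\alpha=\frac{c(T_0-T_m)\Gamma(1-\frac{\alpha}{2})}{\Gamma(1+\frac{\alpha}{2})}\frac{M_{\alpha/2}(\xi_\alpha)}{\xi_\alpha[1-W(-\xi_\alpha;-\frac{\alpha}{2},1)]}$, $T_\alpha(x,t)=T_0-\frac{T_0-T_m}{1-W(-\xi_\alpha;-\frac{\alpha}{2},1)}[1-W(-\frac{x}{\lambda t^{\alpha/2}};-\frac{\alpha}{2},1)]$, $s_\alpha(t)=\lambda\xi_\alpha t^{\alpha/2}$, $\lambda=\sqrt{k/(\rho c)}$, with $\xi_\alpha>0$ the unique solution of $1-W(-x;-\frac{\alpha}{2},1)=\frac{\sqrt{\rho ck}(T_0-T_m)}{q_0\Gamma(1-\frac{\alpha}{2})}$, $x>0$. Then, as $\alpha\to1^-$, this solution coincides with the following one (the classical case $\alpha=1$): $$s_1(t)=2\lambda\mu_1t^{1/2},\quad T_1(x,t)=T_0-q_0\sqrt{\frac{\pi}{\rho ck}}\operatorname{erf}\left(\frac{x}{2\lambda t^{1/2}}\right),$$ $$\ell_1=q_0\sqrt{\frac{c}{\rho k}}\,\frac{\exp(-\mu_1^2)}{\mu_1},\quad \lambda=\sqrt{\frac{k}{\rho c}},$$ where $\mu_1>0$ is the unique solution of $$\operatorname{erf}(x)=\frac{T_0-T_m}{q_0}\sqrt{\frac{\rho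 ck}{\pi}},\quad x>0;$$ in particular the hypothesis on the data becomes $\frac{T_0-T_m}{q_0}\sqrt{\frac{\rho ck}{\pi}}<1$.
   Context: For $0<\alpha<1$ the Caputo derivative is $D^\alpha f(t)=\frac{1}{\Gamma(1-\alpha)}\int_0^t \frac{f'(\tau)}{(t-\tau)^\alpha}d\tau$, and $D^1f=f'$. The Wright function is $W(z;a,b)=\sum_{n\ge0}\frac{z^n}{n!\,\Gamma(na+b)}$ ($a>-1$, $b\in\mathbb{R}$); the Mainardi function is $M_\nu(z)=W(-z;-\nu,1-\nu)$. $\operatorname{erf}(x)=\frac{2}{\sqrt\pi}\int_0^x e^{-u^2}du$. The problem (for $0<\alpha\le 1$): with positive constants $\rho,k,c,\ell$, $\lambda^2=k/(\rho c)$, melting temperature $T_m$, $T_0>T_m$, $q_0>0$, find $s(t)$, $T(x,t)$ and the unknown coefficient with $D^\alpha T=\lambda^2T_{xx}$ in $0<x<s(t)$, $t>0$; $s(0)=0$; $T(x,0)=T(+\infty,t)=T_m$; $T(s(t),t)=T_m$; $-kT_x(s(t),t)=\rho\ell D^\alpha s(t)$; $T(0,t)=T_0$; $kT_x(0,t)=-q_0/t^{\alpha/2}$ for $t>0$. *)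

(* Defs.v *)
From Stdlib Require Import Reals ZArith.
From Coquelicot Require Import Coquelicot.
Open Scope R_scope.

Definition Gamma (x : R) : R :=
  RInt_gen (fun t => Rpower t (x - 1) * exp (- t)) (at_right 0) (Rbar_locally p_infty).

(* 1/Gamma extended to all reals via 1/Gamma(x) = x * 1/Gamma(x+1)
   (so it vanishes at 0,-1,-2,...). *)
Fixpoint rgamma_n (n : nat) (x : R) : R :=
  match n with
  | O => / Gamma x
  | S m => x * rgamma_n m (x + 1)
  end.

Definition rgamma (x : R) : R := rgamma_n (Z.to_nat (up (- x))) x.

Definition Wright (z a b : R) : R :=
  Series (fun n => z ^ n / INR (fact n) * rgamma (INR n * a + b)).

Definition Mainardi (nu z : R) : R := Wright (- z) (- nu) (1 - nu).

Definition erf (x : R) : R := 2 / sqrt PI * RInt (fun u => exp (- u ^ 2)) 0 x.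

Definition ell_alpha (c T0 Tm alpha xi : R) : R :=
  c * (T0 - Tm) * Gamma (1 - alpha / 2) / Gamma (1 + alpha / 2)
  * (Mainardi (alpha / 2) xi / (xi * (1 - Wright (- xi) (- (alpha / 2)) 1))).

Definition T_alpha (lam T0 Tm alpha xi x t : R) : R :=
  T0 - (T0 - Tm) / (1 - Wright (- xi) (- (alpha / 2)) 1)
       * (1 - Wright (- (x / (lam * Rpower t (alpha / 2)))) (- (alpha / 2)) 1).

Definition s_alpha (lam alpha xi t : R) : R := lam * xi * Rpower t (alpha / 2).

Definition s_one (lam mu t : R) : R := 2 * lam * mu * sqrt t.

Definition T_one (rho k c lam T0 q0 x t : R) : R :=
  T0 - q0 * sqrt (PI / (rho * c * k)) * erf (x / (2 * lam * sqrt t)).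

Definition ell_one (rho k c q0 mu : R) : R :=
  q0 * sqrt (c / (rho * k)) * exp (- mu ^ 2) / mu.

(* Main.v *)
(** Write F_nu(x) = 1 - W(-x; -nu, 1), so that F_nu' = M_nu and xi_alpha is a root of F_{alpha/2} = d_alpha.
    As alpha -> 1 the series for F_{alpha/2} and M_{alpha/2} converge locally uniformly to those at nu = 1/2,
    which sum to erf(x/2) and exp(-x^2/4)/sqrt(pi). Local uniformity alone does not keep xi_alpha from escaping
    to infinity; for that F_nu must be nondecreasing, i.e. M_nu >= 0.

    Positivity of M_nu comes from Euler's product N^s prod_{i<=N} (1 - s/i) -> 1/Gamma(1-s): it exhibits M_nu(x)
    as the limit of N^nu A_N(x N^nu), where A_N(y) is the coefficient of z^N in exp(-y (1-z)^nu) (1-z)^(nu-1),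
    which is nonnegative because all coefficients of 1 - (1-z)^nu and of (1-z)^(nu-1) are. The same products,
    bounded uniformly in N, provide the bound on 1/Gamma(1-s) that dominates all the series. *)
Require Import Defs.
From Stdlib Require Import Reals ZArith Lra Lia.
From Coquelicot Require Import Coquelicot.
Open Scope R_scope.

(** * The integral defining Gamma *)

(** The terms of M_nu change sign, so positivity cannot be read off the series. The A_N are not
    handled as coefficients of a power series in z: each is an exponential series in y, and
    multiplication by (1-z)^nu becomes the triangular system A_N' = - sum_k q_k A_{N-k}, with q_k
    the coefficients of (1-z)^nu, obtained from Chu-Vandermonde. Multiplying by exp y removes the k
    = 0 term, the remaining -q_k are nonnegative, and the sign follows by induction on N.

    Domination needs 1/Gamma(1 - n nu) to grow like n^(theta n) with theta < 1, uniformly in nu <=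
    1/2. The true exponent is 1/2; the factor-by-factor estimate used here gives 3/4, which n! still
    beats.

    All facts on Gamma come from its integral. Convexity in t of powers of t gives two-sided bounds
    on Gamma(a + x), hence Euler's limit with an error 2/N uniform in s. That uniformity yields
    continuity of 1/Gamma, needed because nu moves with alpha. At nu = 1/2 the recurrence of 1/Gamma
    turns the series into a first-order linear differential equation. *)

Lemma filterlim_Rplus {T : Type} (F : (T -> Prop) -> Prop) {FF : Filter F} (f g : T -> R) (a b : R) :
  filterlim f F (locally a) -> filterlim g F (locally b) ->
  filterlim (fun t => f t + g t) F (locally (a + b)).
Proof.
  intros Hf Hg.
  exact (filterlim_comp_2 f g plus Hf Hg (filterlim_plus a b)).
Qed.

Lemma filterlim_Rmult {T : Type} (F : (T -> Prop) -> Prop) {FF : Filter F} (f g : T -> R) (a b : R) :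
  filterlim f F (locally a) -> filterlim g F (locally b) ->
  filterlim (fun t => f t * g t) F (locally (a * b)).
Proof.
  intros Hf Hg.
  exact (filterlim_comp_2 f g mult Hf Hg (filterlim_mult a b)).
Qed.

Lemma filterlim_continuous {T : Type} (F : (T -> Prop) -> Prop) {FF : Filter F} (f : T -> R) (h : R -> R) (a : R) :
  filterlim f F (locally a) -> continuous h a ->
  filterlim (fun t => h (f t)) F (locally (h a)).
Proof.
  intros Hf Hh.
  exact (filterlim_comp _ _ _ f h F (locally a) (locally (h a)) Hf Hh).
Qed.

Lemma filterlim_Ropp {T : Type} (F : (T -> Prop) -> Prop) {FF : Filter F} (f : T -> R) (a : R) :
  filterlim f F (locally a) -> filterlim (fun t => - f t) F (locally (- a)).
Proof.
  intros Hf. apply (filterlim_continuous F f Ropp a Hf).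
  exact (filterlim_opp a).
Qed.

Lemma filterlim_Rminus {T : Type} (F : (T -> Prop) -> Prop) {FF : Filter F} (f g : T -> R) (a b : R) :
  filterlim f F (locally a) -> filterlim g F (locally b) ->
  filterlim (fun t => f t - g t) F (locally (a - b)).
Proof.
  intros Hf Hg. apply (filterlim_Rplus F); [exact Hf | now apply (filterlim_Ropp F)].
Qed.

Lemma filterlim_Rinv {T : Type} (F : (T -> Prop) -> Prop) {FF : Filter F} (f : T -> R) (a : R) :
  a <> 0 -> filterlim f F (locally a) -> filterlim (fun t => / f t) F (locally (/ a)).
Proof.
  intros Ha Hf. apply (filterlim_continuous F f Rinv a Hf). now apply continuous_Rinv.
Qed.

Lemma filterlim_Rdiv {T : Type} (F : (T -> Prop) -> Prop) {FF : Filter F} (f g : T -> R) (a b : R) :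
  b <> 0 -> filterlim f F (locally a) -> filterlim g F (locally b) ->
  filterlim (fun t => f t / g t) F (locally (a / b)).
Proof.
  intros Hb Hf Hg. apply (filterlim_Rmult F); [exact Hf | now apply (filterlim_Rinv F)].
Qed.

Lemma filterlim_Rabs_locally {T : Type} (F : (T -> Prop) -> Prop) {FF : Filter F} (f : T -> R) (l : R) :
  filterlim f F (locally l) <-> (forall eps, 0 < eps -> F (fun t => Rabs (f t - l) < eps)).
Proof.
  split.
  - intros H eps He. apply (proj1 (filterlim_locally f l) H (mkposreal eps He)).
  - intros H. apply filterlim_locally. intros [eps He]. exact (H eps He).
Qed.

Lemma filterlim_squeeze {T : Type} (F : (T -> Prop) -> Prop) {FF : Filter F} (f g : T -> R) (l : R) :
  filterlim g F (locally 0) -> F (fun t => Rabs (f t - l) <= g t) -> filterlim f F (locally l).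
Proof.
  intros Hg Hfg. apply (filterlim_Rabs_locally F). intros eps He.
  generalize (filter_and _ _ Hfg (proj1 (filterlim_Rabs_locally F _ _) Hg eps He)).
  apply filter_imp. intros t [H1 H2].
  rewrite Rminus_0_r in H2. apply Rle_lt_trans with (1 := H1).
  apply Rle_lt_trans with (2 := H2). apply Rle_abs.
Qed.

(** * Improper integrals over the positive half-line *)

Lemma near_zero_infty (M : R) :
  filter_prod (at_right 0) (Rbar_locally p_infty) (fun ab : R * R => 0 < fst ab < 1 /\ 1 < snd ab /\ M < snd ab).
Proof.
  apply Filter_prod with (fun a => 0 < a < 1) (fun b => 1 < b /\ M < b).
  - exists (mkposreal 1 Rlt_0_1). intros y Hy Hy0.
    change (Rabs (y - 0) < 1) in Hy. apply Rabs_def2 in Hy. lra.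
  - exists (Rmax 1 M). intros x Hx. split; apply Rle_lt_trans with (2 := Hx); [apply Rmax_l | apply Rmax_r].
  - intros x y Hx Hy. simpl. tauto.
Qed.

Lemma is_RInt_gen_primitive (f F : R -> R) (la lb : R) :
  (forall t, 0 < t -> is_derive F t (f t)) -> (forall t, 0 < t -> continuous f t) ->
  filterlim F (at_right 0) (locally la) -> filterlim F (Rbar_locally p_infty) (locally lb) ->
  is_RInt_gen f (at_right 0) (Rbar_locally p_infty) (lb - la).
Proof.
  intros Hd Hc Ha Hb P HP. unfold filtermapi.
  assert (Hl : filterlim (fun ab => F (snd ab) - F (fst ab))
      (filter_prod (at_right 0) (Rbar_locally p_infty)) (locally (lb - la))).
  { apply (filterlim_Rminus (filter_prod (at_right 0) (Rbar_locally p_infty))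
      (fun ab => F (snd ab)) (fun ab => F (fst ab))).
    - exact (filterlim_comp _ _ _ _ _ _ _ _ filterlim_snd Hb).
    - exact (filterlim_comp _ _ _ _ _ _ _ _ filterlim_fst Ha). }
  generalize (filter_and _ _ (near_zero_infty 0) (Hl P HP : filter_prod _ _ (fun ab => P (F (snd ab) - F (fst ab))))).
  apply filter_imp. intros [a b] [[Ha0 [Hb0 _]] HPab]. simpl in *.
  exists (F b - F a). split; [| exact HPab].
  apply (is_RInt_derive F f); intros x Hx; rewrite Rmin_left in Hx by lra; [apply Hd | apply Hc]; lra.
Qed.

Lemma ex_RInt_pos (f : R -> R) (a b : R) :
  (forall t, 0 < t -> continuous f t) -> 0 < a -> 0 < b -> ex_RInt f a b.
Proof.
  intros Hc Ha Hb. apply (ex_RInt_continuous f). intros z Hz. apply Hc.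
  apply Rlt_le_trans with (2 := proj1 Hz). now apply Rmin_glb_lt.
Qed.

(** The limit is the supremum of the integrals over compact intervals, since enlarging the interval
    cannot decrease the integral of a nonnegative function. *)
Lemma ex_RInt_gen_bounded (f : R -> R) (M : R) :
  (forall t, 0 < t -> continuous f t) -> (forall t, 0 < t -> 0 <= f t) ->
  (forall a b, 0 < a -> a < b -> RInt f a b <= M) ->
  ex_RInt_gen f (at_right 0) (Rbar_locally p_infty).
Proof.
  intros Hc Hp HM.
  set (E := fun y => exists a b, 0 < a /\ a < b /\ y = RInt f a b).
  destruct (completeness E) as [l [Hub Hlub]].
  - exists M. intros y (a & b & Ha & Hab & ->). now apply HM.
  - exists (RInt f 1 2), 1, 2. repeat split; lra.
  - assert (Hmono : forall a0 b0 a b, 0 < a -> a <= a0 -> a0 < b0 -> b0 <= b -> RInt f a0 b0 <= RInt f a b).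
    { intros a0 b0 a b Ha H1 H2 H3.
      assert (E1 : RInt f a b = RInt f a a0 + (RInt f a0 b0 + RInt f b0 b)).
      { assert (C1 := RInt_Chasles f a0 b0 b (ex_RInt_pos f a0 b0 Hc ltac:(lra) ltac:(lra))
          (ex_RInt_pos f b0 b Hc ltac:(lra) ltac:(lra))).
        assert (C2 := RInt_Chasles f a a0 b (ex_RInt_pos f a a0 Hc ltac:(lra) ltac:(lra))
          (ex_RInt_pos f a0 b Hc ltac:(lra) ltac:(lra))).
        unfold plus in C1, C2; simpl in C1, C2. rewrite C1. symmetry. exact C2. }
      assert (0 <= RInt f a a0).
      { apply RInt_ge_0; [lra | apply ex_RInt_pos; trivial; lra | intros x Hx; apply Hp; lra]. }
      assert (0 <= RInt f b0 b).
      { apply RInt_ge_0; [lra | apply ex_RInt_pos; trivial; lra | intros x Hx; apply Hp; lra]. }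
      lra. }
    exists l. intros P [eps HP].
    assert (Hex : exists y, E y /\ l - eps < y).
    { apply Classical_Prop.NNPP. intros Hn.
      assert (l <= l - eps).
      { apply Hlub. intros y Hy. apply Rnot_lt_le. intros Hlt. apply Hn. now exists y. }
      generalize (cond_pos eps). lra. }
    destruct Hex as (y & (a0 & b0 & Ha0 & Hab0 & ->) & Hy).
    apply Filter_prod with (fun a => 0 < a < a0) (fun b => b0 < b).
    + exists (mkposreal a0 Ha0). intros z Hz Hz0.
      change (Rabs (z - 0) < a0) in Hz. apply Rabs_def2 in Hz. lra.
    + now exists b0.
    + intros a b Ha Hb. simpl. exists (RInt f a b). split.
      * apply (RInt_correct f), ex_RInt_pos; trivial; lra.
      * apply HP. change (Rabs (RInt f a b - l) < eps). generalize (cond_pos eps); intros He.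
        assert (RInt f a0 b0 <= RInt f a b) by (apply Hmono; lra).
        assert (RInt f a b <= l) by (apply Hub; exists a, b; repeat split; lra).
        apply Rabs_def1; lra.
Qed.

(** If the limits were in the wrong order, some proper integral of the nonnegative [g - f] would be
    negative. *)
Lemma is_RInt_gen_le (f g : R -> R) (lf lg : R) :
  (forall t, 0 < t -> f t <= g t) ->
  is_RInt_gen f (at_right 0) (Rbar_locally p_infty) lf ->
  is_RInt_gen g (at_right 0) (Rbar_locally p_infty) lg -> lf <= lg.
Proof.
  intros Hfg Hf Hg.
  assert (Hm := is_RInt_gen_minus g f lg lf Hg Hf).
  apply Rnot_lt_le. intros Hlt.
  assert (Hn : locally (minus lg lf) (fun y : R => y < 0)).
  { apply (open_lt 0). unfold minus, plus, opp; simpl. lra. }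
  destruct (filter_ex _ (filter_and _ _ (near_zero_infty 0) (Hm _ Hn))) as [[a b] [[Ha [Hb _]] [y [Hy Hy0]]]].
  simpl in *.
  assert (0 <= y).
  { apply (is_RInt_le (fun _ => 0) (fun t => minus (g t) (f t)) a b 0 y).
    - lra.
    - assert (H := is_RInt_const a b (0 : R)). unfold scal in H; simpl in H. unfold mult in H; simpl in H.
      rewrite Rmult_0_r in H. exact H.
    - exact Hy.
    - intros x Hx. unfold minus, plus, opp; simpl. specialize (Hfg x ltac:(lra)). lra. }
  lra.
Qed.

(** * Convergence and functional equation of Gamma *)

Definition gamma_density (x t : R) : R := Rpower t (x - 1) * exp (- t).

Lemma is_derive_Rpower_exp (x t : R) : 0 < t ->
  is_derive (fun t => Rpower t x * exp (- t)) t (x * gamma_density x t - gamma_density (x + 1) t).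
Proof.
  intros Ht. unfold gamma_density.
  replace (x + 1 - 1) with x by ring.
  replace (x * (Rpower t (x - 1) * exp (- t))) with (x * / t * (Rpower t x * exp (- t))).
  2: { unfold Rminus. rewrite Rpower_plus, Rpower_Ropp, Rpower_1 by lra. ring. }
  unfold Rpower. auto_derive; [lra |]. field; lra.
Qed.

Lemma continuous_gamma_density (x t : R) : 0 < t -> continuous (gamma_density x) t.
Proof.
  intros Ht. apply (ex_derive_continuous (gamma_density x)).
  unfold gamma_density, Rpower. auto_derive. lra.
Qed.

Lemma gamma_density_pos (x t : R) : 0 < gamma_density x t.
Proof. apply Rmult_lt_0_compat; apply exp_pos. Qed.

Lemma Rpower_exp_lim_0 (x : R) : 0 < x ->
  filterlim (fun t => Rpower t x * exp (- t)) (at_right 0) (locally 0).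
Proof.
  intros Hx. apply (filterlim_Rabs_locally (at_right 0)). intros eps He.
  exists (mkposreal (Rpower eps (/ x)) (exp_pos _)). intros t Ht Ht0.
  change (Rabs (t - 0) < Rpower eps (/ x)) in Ht. rewrite Rminus_0_r, Rabs_pos_eq in Ht by lra.
  rewrite Rminus_0_r, Rabs_pos_eq by (left; apply Rmult_lt_0_compat; apply exp_pos).
  apply Rle_lt_trans with (Rpower t x * 1).
  - apply Rmult_le_compat_l; [left; apply exp_pos |]. rewrite <- exp_0. left. apply exp_increasing. lra.
  - rewrite Rmult_1_r. replace eps with (Rpower (Rpower eps (/ x)) x).
    + now apply Rlt_Rpower_l.
    + rewrite Rpower_mult, Rinv_l, Rpower_1; lra.
Qed.

Lemma exp_neg_lim (c C : R) : 0 < c ->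
  filterlim (fun t => exp (C - c * t)) (Rbar_locally p_infty) (locally 0).
Proof.
  intros Hc. apply (filterlim_Rabs_locally (Rbar_locally p_infty)). intros eps He.
  exists ((C - ln eps) / c). intros t Ht.
  rewrite Rminus_0_r, Rabs_pos_eq by (left; apply exp_pos).
  rewrite <- (exp_ln eps) by trivial. apply exp_increasing.
  apply Rmult_lt_compat_r with (r := c) in Ht; [| trivial].
  replace ((C - ln eps) / c * c) with (C - ln eps) in Ht by (field; lra). lra.
Qed.

Lemma ln_le_sub (x : R) : 0 < x -> ln x <= x - 1.
Proof.
  intros Hx. generalize (exp_ineq1_le (ln x)). rewrite exp_ln by trivial. lra.
Qed.

Lemma Rpower_exp_lim_infty (x : R) : 0 < x ->
  filterlim (fun t => Rpower t x * exp (- t)) (Rbar_locally p_infty) (locally 0).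
Proof.
  intros Hx. apply (filterlim_squeeze (Rbar_locally p_infty) _
    (fun t => exp (x * ln (2 * x) - / 2 * t))).
  - apply exp_neg_lim. lra.
  - exists 1. intros t Ht. rewrite Rminus_0_r, Rabs_pos_eq by (left; apply Rmult_lt_0_compat; apply exp_pos).
    unfold Rpower. rewrite <- exp_plus.
    (* The tangent to [ln] at [2 * x] gives t^x <= (2x)^x exp(t/2), so half of the exponential decay
       survives. *)
    assert (H : ln t - ln (2 * x) <= t / (2 * x) - 1).
    { rewrite <- ln_div by lra. apply ln_le_sub. apply Rdiv_lt_0_compat; lra. }
    apply Rmult_le_compat_l with (r := x) in H; [| lra].
    replace (x * (t / (2 * x) - 1)) with (/ 2 * t - x) in H by (field; lra).
    assert (x * ln t + - t <= x * ln (2 * x) - / 2 * t) by lra.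
    destruct H0 as [H0 | ->]; [left; now apply exp_increasing | apply Rle_refl].
Qed.

Lemma is_RInt_gen_gamma_by_parts (x : R) : 0 < x ->
  is_RInt_gen (fun t => x * gamma_density x t - gamma_density (x + 1) t)
    (at_right 0) (Rbar_locally p_infty) 0.
Proof.
  intros Hx. replace 0 with (0 - 0) at 2 by ring.
  apply is_RInt_gen_primitive with (fun t => Rpower t x * exp (- t)).
  - intros t Ht. now apply is_derive_Rpower_exp.
  - intros t Ht. apply (continuous_minus (fun t => x * gamma_density x t) (gamma_density (x + 1))).
    + apply (continuous_scal_r x (gamma_density x)). now apply continuous_gamma_density.
    + now apply continuous_gamma_density.
  - now apply Rpower_exp_lim_0.
  - now apply Rpower_exp_lim_infty.
Qed.

Lemma Rpower_le_1_plus (x t : R) : 0 < t -> 0 < x <= 1 -> Rpower t x <= 1 + t.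
Proof.
  intros Ht Hx. destruct (Rle_lt_dec t 1) as [H | H].
  - apply Rle_trans with 1; [| lra].
    unfold Rpower. rewrite <- exp_0. assert (x * ln t <= 0).
    { assert (ln t <= 0) by (rewrite <- ln_1; apply ln_le; lra). nra. }
    destruct H0 as [H0 | ->]; [left; now apply exp_increasing | apply Rle_refl].
  - apply Rle_trans with (Rpower t 1); [apply Rle_Rpower; lra | rewrite Rpower_1; lra].
Qed.

Lemma ex_RInt_gen_gamma_unit (x : R) : 0 < x <= 1 ->
  ex_RInt_gen (gamma_density x) (at_right 0) (Rbar_locally p_infty).
Proof.
  intros Hx. apply ex_RInt_gen_bounded with (3 / x).
  - intros t Ht. now apply continuous_gamma_density.
  - intros t _. left. apply gamma_density_pos.
  - intros a b Ha Hab.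
    (* Integration by parts trades the density singular at 0 for that of [x + 1], which is at most
       (1+t) exp(-t), with primitive -(2+t) exp(-t). The endpoint [b] contributes at most 1 and the
       endpoint [a] at most 2, whence the bound [3 / x]. *)
    set (G := fun t => / x * (Rpower t x * exp (- t) - (2 + t) * exp (- t))).
    set (g := fun t => / x * ((x * gamma_density x t - gamma_density (x + 1) t) + (1 + t) * exp (- t))).
    assert (HG : is_RInt g a b (G b - G a)).
    { apply (is_RInt_derive G g); intros t Ht; rewrite Rmin_left in Ht by lra.
      - unfold G, g. apply is_derive_scal with (f := fun t => Rpower t x * exp (- t) - (2 + t) * exp (- t)).
        apply (is_derive_plus (fun t => Rpower t x * exp (- t)) (fun t => - ((2 + t) * exp (- t)))).
        + apply is_derive_Rpower_exp; lra.
        + auto_derive; trivial. ring.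
      - apply (ex_derive_continuous g). unfold g, gamma_density, Rpower. auto_derive. lra. }
    apply Rle_trans with (G b - G a).
    + apply (is_RInt_le (gamma_density x) g a b); trivial; [lra | |].
      * apply (RInt_correct (gamma_density x)), ex_RInt_pos; try lra.
        intros t Ht. now apply continuous_gamma_density.
      * intros t Ht. unfold g.
        assert (gamma_density (x + 1) t <= (1 + t) * exp (- t)).
        { unfold gamma_density. replace (x + 1 - 1) with x by ring.
          apply Rmult_le_compat_r; [left; apply exp_pos | apply Rpower_le_1_plus; lra]. }
        replace (gamma_density x t) with (/ x * (x * gamma_density x t)) at 1 by (field; lra).
        apply Rmult_le_compat_l; [left; apply Rinv_0_lt_compat; lra | lra].
    + unfold G.
      assert (Rpower b x * exp (- b) <= 1).
      { apply Rle_trans with ((1 + b) * exp (- b)).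
        - apply Rmult_le_compat_r; [left; apply exp_pos | apply Rpower_le_1_plus; lra].
        - apply Rle_trans with (exp b * exp (- b)).
          + apply Rmult_le_compat_r; [left; apply exp_pos | apply exp_ineq1_le].
          + rewrite <- exp_plus, Rplus_opp_r, exp_0. lra. }
      assert ((2 + a) * exp (- a) <= 2).
      { apply Rle_trans with (2 * (exp a * exp (- a))).
        - rewrite <- Rmult_assoc. apply Rmult_le_compat_r; [left; apply exp_pos |]. generalize (exp_ineq1_le a). lra.
        - rewrite <- exp_plus, Rplus_opp_r, exp_0. lra. }
      assert (0 < Rpower a x * exp (- a)) by (apply Rmult_lt_0_compat; apply exp_pos).
      assert (0 < (2 + b) * exp (- b)) by (apply Rmult_lt_0_compat; [lra | apply exp_pos]).
      unfold Rdiv. rewrite <- Rmult_minus_distr_l, (Rmult_comm 3).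
      apply Rmult_le_compat_l; [left; apply Rinv_0_lt_compat; lra | lra].
Qed.

(** Phrased with [is_RInt_gen] so that it carries convergence from [x] to [x + 1] as well as the
    value. *)
Lemma is_RInt_gen_gamma_succ (x l : R) : 0 < x ->
  is_RInt_gen (gamma_density x) (at_right 0) (Rbar_locally p_infty) l ->
  is_RInt_gen (gamma_density (x + 1)) (at_right 0) (Rbar_locally p_infty) (x * l).
Proof.
  intros Hx Hl.
  assert (H := is_RInt_gen_minus _ _ _ _ (is_RInt_gen_scal _ x _ Hl) (is_RInt_gen_gamma_by_parts x Hx)).
  replace (x * l) with (minus (scal x l) 0).
  2: { unfold minus, plus, opp, scal; simpl. unfold mult; simpl. ring. }
  revert H. apply is_RInt_gen_ext. apply filter_forall. intros ab t _.
  unfold minus, plus, opp, scal; simpl. unfold mult; simpl. ring.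
Qed.

Lemma ex_RInt_gen_gamma (x : R) : 0 < x ->
  ex_RInt_gen (gamma_density x) (at_right 0) (Rbar_locally p_infty).
Proof.
  assert (H : forall n y, 0 < y <= INR n + 1 ->
    ex_RInt_gen (gamma_density y) (at_right 0) (Rbar_locally p_infty)).
  { induction n as [| n IH]; intros y Hy.
    - apply ex_RInt_gen_gamma_unit. simpl in Hy. lra.
    - destruct (Rle_lt_dec y 1) as [H1 | H1]; [apply ex_RInt_gen_gamma_unit; lra |].
      rewrite S_INR in Hy. destruct (IH (y - 1)) as [l Hl]; [lra |].
      exists ((y - 1) * l). replace y with (y - 1 + 1) at 1 by ring.
      apply is_RInt_gen_gamma_succ; [lra | exact Hl]. }
  intros Hx. destruct (nfloor_ex x) as [n Hn]; [lra |]. apply (H n). lra.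
Qed.

Lemma is_RInt_gen_Gamma (x : R) : 0 < x ->
  is_RInt_gen (gamma_density x) (at_right 0) (Rbar_locally p_infty) (Gamma x).
Proof.
  intros Hx. apply (RInt_gen_correct (gamma_density x)). now apply ex_RInt_gen_gamma.
Qed.

Lemma Gamma_eq (x l : R) :
  is_RInt_gen (gamma_density x) (at_right 0) (Rbar_locally p_infty) l -> Gamma x = l.
Proof. intros Hl. exact (is_RInt_gen_unique (gamma_density x) l Hl). Qed.

Lemma Gamma_succ (x : R) : 0 < x -> Gamma (x + 1) = x * Gamma x.
Proof.
  intros Hx. apply Gamma_eq, is_RInt_gen_gamma_succ; trivial. now apply is_RInt_gen_Gamma.
Qed.

Lemma Gamma_1 : Gamma 1 = 1.
Proof.
  apply Gamma_eq. replace 1 with (0 - (-1)) at 2 by ring.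
  apply is_RInt_gen_primitive with (fun t => - exp (- t)).
  - intros t Ht. unfold gamma_density. rewrite Rminus_diag, Rpower_O by trivial.
    auto_derive; trivial. ring.
  - intros t Ht. now apply continuous_gamma_density.
  - replace (-1) with (- exp (- 0)) by (rewrite Ropp_0, exp_0; ring).
    apply (filterlim_filter_le_1 (F := locally 0) (G := at_right 0)).
    + intros P [eps HP]. exists eps. intros y Hy _. now apply HP.
    + apply (ex_derive_continuous (fun t => - exp (- t))). now auto_derive.
  - apply (filterlim_squeeze (Rbar_locally p_infty) _ (fun t => exp (0 - 1 * t))).
    + apply exp_neg_lim. lra.
    + exists 0. intros t Ht. rewrite Rminus_0_r, Rabs_Ropp, Rabs_pos_eq by (left; apply exp_pos).
      right. f_equal. ring.
Qed.


(** * Euler's product and the reciprocal Gamma function *)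

(** Convexity enters as a nondecreasing derivative: at the mean value point [c], the difference
    [df c - df a] has the sign of [t - a]. *)
Lemma tangent_le (f df : R -> R) (a t : R) :
  0 < a -> 0 < t -> (forall u, 0 < u -> is_derive f u (df u)) ->
  (forall u v, 0 < u -> u <= v -> df u <= df v) ->
  f a + df a * (t - a) <= f t.
Proof.
  intros Ha Ht Hd Hm.
  destruct (MVT_gen f a t df) as [c [Hc Heq]].
  - intros x Hx. apply Hd. assert (0 < Rmin a t) by (now apply Rmin_glb_lt). lra.
  - intros x Hx. assert (0 < Rmin a t) by (now apply Rmin_glb_lt).
    apply continuity_pt_filterlim. apply (ex_derive_continuous f). exists (df x). apply Hd. lra.
  - assert (0 < c) by (assert (0 < Rmin a t) by (now apply Rmin_glb_lt); lra).
    destruct (Rle_lt_dec a t) as [H1 | H1].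
    + rewrite Rmin_left, Rmax_right in Hc by lra. assert (df a <= df c) by (apply Hm; lra). nra.
    + rewrite Rmin_right, Rmax_left in Hc by lra. assert (df c <= df a) by (apply Hm; lra). nra.
Qed.

Lemma is_derive_Rpower (x t : R) : 0 < t -> is_derive (fun t => Rpower t x) t (x * Rpower t (x - 1)).
Proof.
  intros Ht. unfold Rminus. rewrite Rpower_plus, Rpower_Ropp, Rpower_1 by lra.
  unfold Rpower. auto_derive; [lra |]. field; lra.
Qed.

Lemma Rpower_decr (x u v : R) : x <= 0 -> 0 < u -> u <= v -> Rpower v x <= Rpower u x.
Proof.
  intros Hx Hu Huv. unfold Rpower. assert (ln u <= ln v) by (apply ln_le; lra).
  assert (H1 : x * ln v <= x * ln u) by nra.
  destruct H1 as [H1 | ->]; [left; now apply exp_increasing | apply Rle_refl].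
Qed.

(* Integrate the tangent-line bound of the concave [t^x] at [t = a] against the density of [Gamma a]. *)
Lemma Gamma_upper (a x : R) : 0 < a -> 0 < x <= 1 -> Gamma (a + x) <= Rpower a x * Gamma a.
Proof.
  intros Ha Hx. assert (Ha1 : 0 < a + 1) by lra. assert (Hax : 0 < a + x) by lra.
  assert (Hl := is_RInt_gen_plus _ _ _ _
    (is_RInt_gen_scal _ ((1 - x) * Rpower a x) _ (is_RInt_gen_Gamma a Ha))
    (is_RInt_gen_scal _ (x * Rpower a (x - 1)) _ (is_RInt_gen_Gamma (a + 1) Ha1))).
  replace (Rpower a x * Gamma a) with
    (plus (scal ((1 - x) * Rpower a x) (Gamma a)) (scal (x * Rpower a (x - 1)) (Gamma (a + 1)))).
  - apply (fun H => is_RInt_gen_le _ _ _ _ H (is_RInt_gen_Gamma (a + x) Hax) Hl).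
    intros t Ht. unfold plus, scal; simpl. unfold mult; simpl. unfold gamma_density.
    replace (a + x - 1) with ((a - 1) + x) by ring. replace (a + 1 - 1) with ((a - 1) + 1) by ring.
    rewrite !(Rpower_plus _ _ t), Rpower_1 by trivial.
    assert (H := tangent_le (fun t => - Rpower t x) (fun t => - (x * Rpower t (x - 1))) a t Ha Ht).
    assert (H' : Rpower t x <= Rpower a x + x * Rpower a (x - 1) * (t - a)).
    { assert (- Rpower a x + - (x * Rpower a (x - 1)) * (t - a) <= - Rpower t x); [| lra].
      apply H.
      - intros u Hu. apply (is_derive_opp (fun t => Rpower t x)). now apply is_derive_Rpower.
      - intros u v Hu Huv. assert (Rpower v (x - 1) <= Rpower u (x - 1)) by (apply Rpower_decr; lra). nra. }
    replace (x * Rpower a (x - 1) * (t - a)) with (x * Rpower a (x - 1) * t - x * Rpower a x) in H'.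
    2: { replace (Rpower a x) with (Rpower a (x - 1) * a); [ring |].
         rewrite <- (Rpower_1 a) at 2 by trivial. rewrite <- Rpower_plus. f_equal. ring. }
    assert (Hp : 0 < Rpower t (a - 1) * exp (- t)) by (apply Rmult_lt_0_compat; apply exp_pos).
    nra.
  - rewrite Gamma_succ by trivial. unfold plus, scal; simpl. unfold mult; simpl.
    replace (Rpower a x) with (Rpower a (x - 1) * a); [ring |].
    rewrite <- (Rpower_1 a) at 2 by trivial. rewrite <- Rpower_plus. f_equal. ring.
Qed.

(* Likewise for the convex [t^(x-1)]; at [t = a + 1] the linear term integrates to zero. *)
Lemma Gamma_lower (a x : R) : 0 < a -> 0 < x <= 1 -> Rpower (a + 1) (x - 1) * Gamma (a + 1) <= Gamma (a + x).
Proof.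
  intros Ha Hx.
  set (m := a + 1). assert (Hm : 0 < m) by (unfold m; lra).
  assert (Hm1 : 0 < m + 1) by lra. assert (Hax : 0 < a + x) by lra.
  assert (Hl := is_RInt_gen_plus _ _ _ _
    (is_RInt_gen_scal _ (Rpower m (x - 1) - (x - 1) * Rpower m (x - 2) * m) _ (is_RInt_gen_Gamma m Hm))
    (is_RInt_gen_scal _ ((x - 1) * Rpower m (x - 2)) _ (is_RInt_gen_Gamma (m + 1) Hm1))).
  replace (Rpower m (x - 1) * Gamma m) with
    (plus (scal (Rpower m (x - 1) - (x - 1) * Rpower m (x - 2) * m) (Gamma m))
       (scal ((x - 1) * Rpower m (x - 2)) (Gamma (m + 1)))).
  - apply (fun H => is_RInt_gen_le _ _ _ _ H Hl (is_RInt_gen_Gamma (a + x) Hax)).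
    intros t Ht. unfold plus, scal; simpl. unfold mult; simpl. unfold gamma_density.
    replace (a + x - 1) with ((m - 1) + (x - 1)) by (unfold m; ring).
    replace (m + 1 - 1) with ((m - 1) + 1) by ring.
    rewrite !(Rpower_plus _ _ t), Rpower_1 by trivial.
    assert (H := tangent_le (fun t => Rpower t (x - 1)) (fun t => (x - 1) * Rpower t (x - 1 - 1)) m t Hm Ht).
    replace (x - 1 - 1) with (x - 2) in H by ring.
    assert (H' : Rpower m (x - 1) + (x - 1) * Rpower m (x - 2) * (t - m) <= Rpower t (x - 1)).
    { apply H.
      - intros u Hu. replace (x - 2) with (x - 1 - 1) by ring. now apply is_derive_Rpower.
      - intros u v Hu Huv. assert (Rpower v (x - 2) <= Rpower u (x - 2)) by (apply Rpower_decr; lra). nra. }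
    assert (Hp : 0 < Rpower t (m - 1) * exp (- t)) by (apply Rmult_lt_0_compat; apply exp_pos).
    nra.
  - rewrite Gamma_succ by trivial. unfold plus, scal; simpl. unfold mult; simpl. ring.
Qed.

Lemma Gamma_INR (n : nat) : Gamma (INR (S n)) = INR (fact n).
Proof.
  induction n as [| n IH]; [apply Gamma_1 |].
  rewrite S_INR, Gamma_succ, IH by (apply lt_0_INR; lia).
  rewrite <- mult_INR. f_equal.
Qed.

(** [Gamma_lower] at [a = 1] gives x Gamma(x) = Gamma(1+x) >= 2^(x-1) >= 1/2. *)
Lemma Gamma_unit_ge (x : R) : 0 < x <= 1 -> / (2 * x) <= Gamma x.
Proof.
  intros Hx. assert (H := Gamma_lower 1 x Rlt_0_1 Hx).
  replace (1 + 1) with (INR 2) in H by (simpl; ring). rewrite Gamma_INR in H.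
  rewrite (Rplus_comm 1), Gamma_succ in H by lra. simpl in H.
  assert (/ 2 <= Rpower (1 + 1) (x - 1)).
  { replace (/ 2) with (Rpower (1 + 1) (- (1))) by (rewrite Rpower_Ropp, Rpower_1 by lra; f_equal; ring).
    apply Rle_Rpower; lra. }
  apply Rmult_le_reg_l with x; [lra |]. rewrite Rinv_mult. replace (x * (/ 2 * / x)) with (/ 2) by (field; lra). lra.
Qed.

Lemma Gamma_unit_pos (x : R) : 0 < x <= 1 -> 0 < Gamma x.
Proof.
  intros Hx. apply Rlt_le_trans with (2 := Gamma_unit_ge x Hx). apply Rinv_0_lt_compat. lra.
Qed.

(* Truncation of Euler's product: [N^s * prod_{1 <= i <= N} (1 - s/i)] tends to [1/Gamma(1-s)]. *)
Fixpoint euler_prod (N : nat) (s : R) : R :=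
  match N with
  | O => 1
  | S m => euler_prod m s * (1 - s / INR (S m))
  end.

Definition euler_gamma (N : nat) (s : R) : R := Rpower (INR N) s * euler_prod N s.

Lemma rgamma_pos (x : R) : 0 < x -> rgamma x = / Gamma x.
Proof.
  intros Hx. unfold rgamma. destruct (archimed (- x)) as [H1 H2].
  assert ((up (- x) <= 0)%Z).
  { apply Z.lt_succ_r. simpl. apply lt_IZR. lra. }
  replace (Z.to_nat (up (- x))) with O by lia. reflexivity.
Qed.

(** For [x <= 0] the recursion depth drops by exactly one from [x] to [x + 1]. Since [up] is strict,
    the depth at [x = 0] is already 1, and the factor [x] produces the zero there. *)
Lemma rgamma_step (x : R) : rgamma x = x * rgamma (x + 1).
Proof.
  destruct (Rlt_le_dec 0 x) as [Hx | Hx].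
  - rewrite !rgamma_pos, Gamma_succ by lra.
    rewrite Rinv_mult, <- Rmult_assoc, Rinv_r, Rmult_1_l by lra. reflexivity.
  - unfold rgamma at 1. destruct (archimed (- x)) as [H1 H2].
    assert (H3 : (0 < up (- x))%Z) by (apply lt_IZR; lra).
    replace (Z.to_nat (up (- x))) with (S (Z.to_nat (up (- (x + 1))))); [reflexivity |].
    replace (up (- (x + 1))) with (up (- x) - 1)%Z; [lia |].
    apply tech_up; rewrite minus_IZR; lra.
Qed.

(** The left product is (1-s)(2-s)...(N-s) Gamma(1-s), so the functional equation telescopes. *)
Lemma euler_prod_Gamma (N : nat) (s : R) : s < 1 ->
  euler_prod N s * INR (fact N) * Gamma (1 - s) = Gamma (INR N + (1 - s)).
Proof.
  intros Hs. induction N as [| N IH].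
  - simpl. rewrite Rplus_0_l. ring.
  - replace (INR (S N) + (1 - s)) with (INR N + (1 - s) + 1) by (rewrite S_INR; ring).
    rewrite Gamma_succ, <- IH by (generalize (pos_INR N); lra).
    rewrite fact_simpl, mult_INR. cbn [euler_prod]. rewrite S_INR.
    field. generalize (pos_INR N); lra.
Qed.

(** With n = [S N], the quotient of the two sides is n^s Gamma(n+1-s)/n!. [Gamma_upper] and
    [Gamma_lower] at [a = n], [x = 1 - s] place it between (n/(n+1))^s and 1. *)
Lemma euler_gamma_bounds (N : nat) (s : R) : 0 <= s < 1 ->
  INR (S N) / (INR (S N) + 1) * rgamma (1 - s) <= euler_gamma (S N) s <= rgamma (1 - s).
Proof.
  intros Hs. set (n := INR (S N)).
  assert (Hn : 0 < n) by (apply lt_0_INR; lia).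
  assert (HG := Gamma_unit_pos (1 - s) ltac:(lra)).
  assert (Hf : 0 < INR (fact N)) by apply INR_fact_lt_0.
  assert (HGn : Gamma n = INR (fact N)) by apply Gamma_INR.
  assert (HE : euler_gamma (S N) s =
    Rpower n s * (Gamma (n + (1 - s)) / (n * INR (fact N))) * rgamma (1 - s)).
  { unfold euler_gamma. fold n. rewrite rgamma_pos by lra.
    change (n + (1 - s)) with (INR (S N) + (1 - s)).
    rewrite <- euler_prod_Gamma, fact_simpl, mult_INR by lra. fold n. field. lra. }
  assert (Hr : 0 < rgamma (1 - s)) by (rewrite rgamma_pos by lra; now apply Rinv_0_lt_compat).
  assert (Hp : 0 < Rpower n s) by apply exp_pos.
  rewrite HE. split.
  - apply Rmult_le_compat_r; [lra |].
    assert (H := Gamma_lower n (1 - s) Hn ltac:(lra)).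
    rewrite (Gamma_succ n Hn) in H. rewrite HGn in H.
    replace (1 - s - 1) with (- s) in H by ring. rewrite Rpower_Ropp in H.
    apply Rle_trans with (Rpower n s * (/ Rpower (n + 1) s * (n * INR (fact N)) / (n * INR (fact N)))).
    + replace (/ Rpower (n + 1) s * (n * INR (fact N)) / (n * INR (fact N))) with (/ Rpower (n + 1) s)
        by (field; repeat split; try lra; apply Rgt_not_eq, exp_pos).
      assert (Hp1 : 0 < Rpower (n + 1) (1 - s)) by apply exp_pos.
      assert (E1 : Rpower (n + 1) (1 - s) * Rpower (n + 1) s = n + 1).
      { rewrite <- Rpower_plus. replace (1 - s + s) with 1 by ring. apply Rpower_1; lra. }
      assert (E2 : Rpower n (1 - s) * Rpower n s = n).
      { rewrite <- Rpower_plus. replace (1 - s + s) with 1 by ring. apply Rpower_1; lra. }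
      assert (Hle : Rpower n (1 - s) <= Rpower (n + 1) (1 - s)) by (apply Rle_Rpower_l; lra).
      assert (Hp2 : 0 < Rpower (n + 1) s) by apply exp_pos.
      apply Rmult_le_reg_r with ((n + 1) * Rpower (n + 1) s); [apply Rmult_lt_0_compat; lra |].
      replace (n / (n + 1) * ((n + 1) * Rpower (n + 1) s)) with (n * Rpower (n + 1) s) by (field; lra).
      replace (Rpower n s * / Rpower (n + 1) s * ((n + 1) * Rpower (n + 1) s)) with (Rpower n s * (n + 1)) by (field; lra).
      apply Rle_trans with (Rpower n (1 - s) * Rpower n s * Rpower (n + 1) s); [rewrite E2; lra |].
      apply Rle_trans with (Rpower n s * (Rpower (n + 1) (1 - s) * Rpower (n + 1) s)); [| rewrite E1; lra].
      assert (0 < Rpower n s * Rpower (n + 1) s) by (now apply Rmult_lt_0_compat). nra.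
    + apply Rmult_le_compat_l; [lra |]. apply Rmult_le_compat_r; [| exact H].
      left. apply Rinv_0_lt_compat. now apply Rmult_lt_0_compat.
  - rewrite <- (Rmult_1_l (rgamma (1 - s))) at 2. apply Rmult_le_compat_r; [lra |].
    assert (H := Gamma_upper n (1 - s) Hn ltac:(lra)).
    rewrite HGn in H.
    assert (E2 : Rpower n s * Rpower n (1 - s) = n).
    { rewrite <- Rpower_plus. replace (s + (1 - s)) with 1 by ring. apply Rpower_1; lra. }
    apply Rle_trans with (Rpower n s * (Rpower n (1 - s) * INR (fact N) / (n * INR (fact N)))).
    + apply Rmult_le_compat_l; [lra |]. apply Rmult_le_compat_r; [| exact H].
      left. apply Rinv_0_lt_compat. now apply Rmult_lt_0_compat.
    + right. replace (Rpower n s * (Rpower n (1 - s) * INR (fact N) / (n * INR (fact N)))) with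
        (Rpower n s * Rpower n (1 - s) / n) by (field; lra).
      rewrite E2. field. lra.
Qed.

Lemma rgamma_0 : rgamma 0 = 0.
Proof. rewrite rgamma_step. ring. Qed.

Lemma rgamma_unit_bounds (x : R) : 0 <= x <= 1 -> 0 <= rgamma x <= 2 * x.
Proof.
  intros Hx. destruct (proj1 Hx) as [H | <-]; [| rewrite rgamma_0; lra].
  rewrite rgamma_pos by trivial. split; [left; apply Rinv_0_lt_compat, Gamma_unit_pos; lra |].
  rewrite <- (Rinv_inv (2 * x)). apply Rinv_le_contravar; [apply Rinv_0_lt_compat; lra |].
  apply Gamma_unit_ge. lra.
Qed.

(** The rate does not depend on [s], which makes the convergence uniform; the 2 is the bound of
    [rgamma_unit_bounds] on the unit interval. *)
Lemma euler_gamma_dist (N : nat) (s : R) : 0 <= s < 1 ->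
  Rabs (euler_gamma (S N) s - rgamma (1 - s)) <= 2 / INR (S N).
Proof.
  intros Hs. destruct (euler_gamma_bounds N s Hs) as [H1 H2].
  destruct (rgamma_unit_bounds (1 - s)) as [H3 H4]; [lra |].
  set (n := INR (S N)) in *. assert (Hn : 0 < n) by (apply lt_0_INR; lia).
  rewrite Rabs_left1 by lra.
  apply Rle_trans with (rgamma (1 - s) - n / (n + 1) * rgamma (1 - s)); [lra |].
  replace (rgamma (1 - s) - n / (n + 1) * rgamma (1 - s)) with (rgamma (1 - s) * / (n + 1)) by (field; lra).
  apply Rmult_le_compat; try lra.
  - left. apply Rinv_0_lt_compat; lra.
  - apply Rinv_le_contravar; lra.
Qed.

Lemma is_lim_seq_inv_INR : is_lim_seq (fun n => / INR n) 0.
Proof.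
  replace (Finite 0) with (Rbar_inv p_infty) by reflexivity.
  apply is_lim_seq_inv; [apply is_lim_seq_INR | discriminate].
Qed.

(** Replacing s by s + 1 shifts the numerators i - s by one place: a factor -s enters and N - s
    leaves. *)
Lemma euler_prod_succ (N : nat) (s : R) :
  euler_prod N (s + 1) * (INR N - s) = euler_prod N s * - s.
Proof.
  induction N as [| N IH]; [simpl; ring |].
  cbn [euler_prod]. assert (HN := pos_INR N). rewrite S_INR.
  replace (euler_prod N (s + 1) * (1 - (s + 1) / (INR N + 1)) * (INR N + 1 - s)) with
    (euler_prod N (s + 1) * (INR N - s) * (1 - s / (INR N + 1))) by (field; lra).
  rewrite IH. ring.
Qed.

Lemma euler_gamma_lim (s : R) : 0 <= s ->
  is_lim_seq (fun N => euler_gamma N s) (rgamma (1 - s)).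
Proof.
  assert (H : forall n s, 0 <= s < INR n + 1 -> is_lim_seq (fun N => euler_gamma N s) (rgamma (1 - s))).
  { clear s. induction n as [| n IH]; intros s Hs.
    - simpl in Hs. apply is_lim_seq_incr_1.
      apply (filterlim_squeeze eventually _ (fun N => 2 * / INR (S N))).
      + replace 0 with (2 * 0) by ring.
        apply (is_lim_seq_scal_l (fun N => / INR (S N)) 2 0).
        apply (is_lim_seq_incr_1 (fun n => / INR n)), is_lim_seq_inv_INR.
      + apply filter_forall. intros N. apply euler_gamma_dist. lra.
    - destruct (Rlt_le_dec s 1) as [H1 | H1].
      + apply IH. generalize (pos_INR n). lra.
      + rewrite S_INR in Hs. set (u := s - 1). assert (Hu : 0 <= u < INR n + 1) by (unfold u; lra).
        replace s with (u + 1) by (unfold u; ring).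
        replace (rgamma (1 - (u + 1))) with (rgamma (1 - u) * (- u * 1)).
        2: { rewrite (rgamma_step (1 - (u + 1))). replace (1 - (u + 1) + 1) with (1 - u) by ring. ring. }
        destruct (nfloor_ex u (proj1 Hu)) as [m Hm].
        (* Passing from [u] to [u + 1] multiplies the truncated product by N (-u)/(N-u), which tends
           to -u, the factor in the recurrence of [rgamma]. Taking N > u keeps the denominator
           nonzero. *)
        apply is_lim_seq_ext_loc with (fun N => euler_gamma N u * (- u * / (1 - u * / INR N))).
        * exists (S (S m)). intros N HN.
          assert (HNu : u < INR N).
          { apply Rlt_trans with (1 := proj2 Hm). rewrite <- S_INR. apply lt_INR. lia. }
          unfold euler_gamma. rewrite Rpower_plus, Rpower_1 by lra.
          replace (euler_prod N (u + 1)) with (euler_prod N u * - u / (INR N - u)).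
          2: { rewrite <- euler_prod_succ. field. lra. }
          field. lra.
        * apply (filterlim_Rmult eventually _ _ _ _ (IH u Hu)).
          apply (filterlim_Rmult eventually); [apply filterlim_const |].
          replace (locally 1) with (locally (/ 1)) by (f_equal; apply Rinv_1). apply (filterlim_Rinv eventually); [lra |].
          replace (locally 1) with (locally (1 - u * 0)) by (f_equal; ring).
          apply (filterlim_Rminus eventually); [apply filterlim_const |].
          apply (filterlim_Rmult eventually); [apply filterlim_const | apply is_lim_seq_inv_INR]. }
  intros Hs. destruct (nfloor_ex s Hs) as [n Hn]. apply (H n). lra.
Qed.

Lemma continuous_euler_gamma (N : nat) (s : R) : continuous (euler_gamma N) s.
Proof.
  apply (continuous_mult (fun s => Rpower (INR N) s)).
  - apply (ex_derive_continuous (fun s => Rpower (INR N) s)). unfold Rpower. now auto_derive.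
  - induction N as [| N IH]; [apply continuous_const |].
    apply (continuous_mult (euler_prod N)); [exact IH |].
    apply (ex_derive_continuous (fun s => 1 - s / INR (S N))).
    assert (INR (S N) <> 0) by (apply not_0_INR; lia). now auto_derive.
Qed.

Lemma continuous_rgamma_unit (x : R) : 0 < x < 1 -> continuous rgamma x.
Proof.
  intros Hx. apply (filterlim_Rabs_locally (locally x)). intros eps He.
  (* A uniform limit of continuous functions: [S N] above 6/eps makes each of the two approximation
     errors smaller than eps/3. *)
  destruct (nfloor_ex (6 / eps)) as [N HN].
  { left. apply Rdiv_lt_0_compat; lra. }
  assert (HNe : 2 / INR (S N) < eps / 3).
  { rewrite <- S_INR in HN. assert (0 < INR (S N)) by (apply lt_0_INR; lia).
    apply Rmult_lt_reg_r with (INR (S N)); [trivial |].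
    replace (2 / INR (S N) * INR (S N)) with 2 by (field; lra).
    assert (H1 := Rmult_lt_compat_r eps _ _ He (proj2 HN)).
    replace (6 / eps * eps) with 6 in H1 by (field; lra). lra. }
  assert (Hc : continuous (fun y => euler_gamma (S N) (1 - y)) x).
  { apply (continuous_comp (fun y => 1 - y) (euler_gamma (S N))); [| apply continuous_euler_gamma].
    apply (ex_derive_continuous (fun y => 1 - y)). now auto_derive. }
  assert (Hl := proj1 (filterlim_Rabs_locally (locally x) _ _) Hc (eps / 3) ltac:(lra)).
  assert (Hopen : locally x (fun y => 0 < y /\ y < 1)).
  { apply (filter_and (F := locally x)); [apply (open_gt 0) | apply (open_lt 1)]; lra. }
  generalize (filter_and _ _ Hl Hopen). apply filter_imp. intros y [H1 H2].
  assert (D1 := euler_gamma_dist N (1 - y) ltac:(lra)).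
  assert (D2 := euler_gamma_dist N (1 - x) ltac:(lra)).
  change R in y.
  replace (1 - (1 - y)) with y in D1 by ring. replace (1 - (1 - x)) with x in D2 by ring.
  apply Rabs_def2 in H1.
  apply Rle_lt_trans with (1 := D1) in HNe as D1'. apply Rle_lt_trans with (1 := D2) in HNe as D2'.
  apply Rabs_def2 in D1'. apply Rabs_def2 in D2'. apply Rabs_def1; lra.
Qed.

Lemma continuous_rgamma (x : R) : x < 1 -> continuous rgamma x.
Proof.
  assert (H : forall n x, - INR n < x < 1 -> continuous rgamma x).
  { clear x. induction n as [| n IH]; intros x Hx.
    - simpl in Hx. apply continuous_rgamma_unit. lra.
    - destruct (Rlt_le_dec 0 x) as [H1 | H1]; [apply continuous_rgamma_unit; lra |].
      destruct H1 as [H1 | ->].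
      + rewrite S_INR in Hx.
        apply continuous_ext with (fun x => x * rgamma (x + 1)); [intros y; symmetry; apply rgamma_step |].
        apply (continuous_mult (fun x : R => x)); [apply continuous_id |].
        apply (continuous_comp (fun x => x + 1) rgamma).
        * apply (ex_derive_continuous (fun y => y + 1)). now auto_derive.
        * apply IH. lra.
      (* At 0 the recurrence would call for continuity at 1, which is not covered. The linear bound
         on the unit interval gives |[rgamma y]| <= 2|y| on both sides of 0 instead. *)
      + apply (filterlim_squeeze (locally 0) _ (fun y => 2 * Rabs y)).
        * assert (H2 : filterlim (fun y => 2 * Rabs y) (locally 0) (locally (2 * Rabs 0))).
          { apply (filterlim_Rmult (locally 0)); [apply filterlim_const | apply continuous_Rabs]. }
          rewrite Rabs_R0, Rmult_0_r in H2. exact H2.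
        * exists (mkposreal 1 Rlt_0_1). intros y Hy. change (Rabs (y - 0) < 1) in Hy.
          apply Rabs_def2 in Hy. rewrite rgamma_0, Rminus_0_r.
          destruct (Rle_lt_dec 0 y) as [H2 | H2].
          -- destruct (rgamma_unit_bounds y) as [H3 H4]; [lra |]. rewrite !Rabs_pos_eq; lra.
          -- rewrite rgamma_step, Rabs_mult. destruct (rgamma_unit_bounds (y + 1)) as [H3 H4]; [lra |].
             rewrite (Rabs_pos_eq (rgamma _)) by lra. assert (0 <= Rabs y) by apply Rabs_pos. nra. }
  intros Hx. destruct (nfloor_ex (Rabs x) (Rabs_pos x)) as [n Hn].
  apply (H (S n)). rewrite S_INR. assert (H0 := Rle_abs (- x)). rewrite Rabs_Ropp in H0. lra.
Qed.

(** * The Gaussian integral *)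

Definition gauss (x : R) : R := RInt (fun u => exp (- u ^ 2)) 0 x.

Lemma continuous_gauss_density (x : R) : continuous (fun u => exp (- u ^ 2)) x.
Proof. apply (ex_derive_continuous (fun u => exp (- u ^ 2))). now auto_derive. Qed.

Lemma is_derive_gauss (x : R) : is_derive gauss x (exp (- x ^ 2)).
Proof.
  apply (is_derive_RInt (fun u => exp (- u ^ 2)) gauss 0 x).
  - apply filter_forall. intros y. apply (RInt_correct (fun u => exp (- u ^ 2))).
    apply (ex_RInt_continuous (fun u => exp (- u ^ 2))). intros z _. apply continuous_gauss_density.
  - apply continuous_gauss_density.
Qed.

Lemma gauss_0 : gauss 0 = 0.
Proof. exact (RInt_point 0 (fun u => exp (- u ^ 2))). Qed.

Lemma gauss_lt (x y : R) : x < y -> gauss x < gauss y.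
Proof.
  intros Hxy. apply (incr_function gauss m_infty p_infty (fun x => exp (- x ^ 2))); simpl; trivial.
  - intros z _ _. apply is_derive_gauss.
  - intros z _ _. apply exp_pos.
Qed.

(* Chosen so that [gauss x ^ 2 + gauss_aux x] is constant. *)
Definition gauss_aux (x : R) : R := RInt (fun t => exp (- (x ^ 2 * (1 + t ^ 2))) / (1 + t ^ 2)) 0 1.

Lemma one_plus_sqr_pos (t : R) : 0 < 1 + t ^ 2.
Proof. generalize (pow2_ge_0 t). lra. Qed.

Lemma ex_RInt_gauss_aux (x : R) : ex_RInt (fun t => exp (- (x ^ 2 * (1 + t ^ 2))) / (1 + t ^ 2)) 0 1.
Proof.
  apply (ex_RInt_continuous (fun t => exp (- (x ^ 2 * (1 + t ^ 2))) / (1 + t ^ 2))). intros t _.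
  apply (ex_derive_continuous (fun t => exp (- (x ^ 2 * (1 + t ^ 2))) / (1 + t ^ 2))).
  generalize (one_plus_sqr_pos t); intros Ht. auto_derive. simpl in Ht. lra.
Qed.

Lemma is_derive_gauss_aux_integrand (x t : R) :
  is_derive (fun u => exp (- (u ^ 2 * (1 + t ^ 2))) / (1 + t ^ 2)) x (- 2 * x * exp (- (x ^ 2 * (1 + t ^ 2)))).
Proof.
  generalize (one_plus_sqr_pos t); intros Ht. auto_derive; [trivial |]. simpl in Ht |- *. field. lra.
Qed.

(** Differentiating under the integral sign cancels the denominator 1 + t^2. The factor exp(-x^2)
    comes out, and the substitution u = x t turns the rest into [gauss x]. *)
Lemma is_derive_gauss_aux (x : R) : is_derive gauss_aux x (- 2 * exp (- x ^ 2) * gauss x).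
Proof.
  assert (H : is_derive gauss_aux x
    (RInt (fun t => Derive (fun u => exp (- (u ^ 2 * (1 + t ^ 2))) / (1 + t ^ 2)) x) 0 1)).
  { apply (is_derive_RInt_param (fun u t => exp (- (u ^ 2 * (1 + t ^ 2))) / (1 + t ^ 2)) 0 1 x).
    - apply filter_forall. intros y t _. eexists. apply is_derive_gauss_aux_integrand.
    - intros t _.
      apply continuity_2d_pt_ext with (fun u v => - 2 * u * exp (- (u ^ 2 * (1 + v ^ 2)))).
      + intros u v. symmetry. apply is_derive_unique, is_derive_gauss_aux_integrand.
      + apply continuity_2d_pt_mult.
        * apply continuity_2d_pt_mult; [apply continuity_2d_pt_const | apply continuity_2d_pt_id1].
        * apply (continuity_1d_2d_pt_comp exp (fun u v => - (u ^ 2 * (1 + v ^ 2)))).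
          -- apply derivable_continuous_pt, derivable_pt_exp.
          -- apply continuity_2d_pt_opp, continuity_2d_pt_mult; [| apply continuity_2d_pt_plus; [apply continuity_2d_pt_const |]];
             (apply continuity_2d_pt_mult; [| apply continuity_2d_pt_mult; [| apply continuity_2d_pt_const]]);
             try apply continuity_2d_pt_id1; apply continuity_2d_pt_id2.
    - apply filter_forall. intros y. apply ex_RInt_gauss_aux. }
  replace (- 2 * exp (- x ^ 2) * gauss x) with
    (RInt (fun t => Derive (fun u => exp (- (u ^ 2 * (1 + t ^ 2))) / (1 + t ^ 2)) x) 0 1); [exact H |].
  rewrite (RInt_ext _ (fun t => scal (- 2 * exp (- x ^ 2)) (scal x (exp (- (x * t + 0) ^ 2))))).
  - transitivity (- 2 * exp (- x ^ 2) * RInt (fun t => x * exp (- (x * t + 0) ^ 2)) 0 1).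
    + apply (RInt_scal (fun t => x * exp (- (x * t + 0) ^ 2)) 0 1 (- 2 * exp (- x ^ 2))).
      apply (ex_RInt_continuous (fun t => x * exp (- (x * t + 0) ^ 2))). intros z _.
      apply (ex_derive_continuous (fun t => x * exp (- (x * t + 0) ^ 2))). now auto_derive.
    + f_equal. assert (Hc := RInt_comp_lin (fun u => exp (- u ^ 2)) x 0 0 1).
      rewrite Rmult_0_r, Rmult_1_r, !Rplus_0_r in Hc. apply Hc.
      apply (ex_RInt_continuous (fun u => exp (- u ^ 2))). intros z _. apply continuous_gauss_density.
  - intros t _. apply (eq_trans (is_derive_unique _ _ _ (is_derive_gauss_aux_integrand x t))).
    unfold scal; simpl. unfold mult; simpl.
    replace (- (x * (x * 1) * (1 + t * (t * 1)))) with (- (x * (x * 1)) + - ((x * t + 0) * ((x * t + 0) * 1))) by ring.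
    rewrite exp_plus. ring.
Qed.

Lemma gauss_aux_0 : gauss_aux 0 = PI / 4.
Proof.
  unfold gauss_aux. rewrite (RInt_ext _ (fun t => / (1 + t ^ 2))).
  - apply is_RInt_unique. rewrite <- atan_1. replace (atan 1) with (atan 1 - atan 0) by (rewrite atan_0; ring).
    apply (is_RInt_derive atan (fun t => / (1 + t ^ 2))).
    + intros t _. apply is_derive_Reals, derivable_pt_lim_atan.
    + intros t _. apply (ex_derive_continuous (fun t => / (1 + t ^ 2))).
      generalize (one_plus_sqr_pos t); intros Ht. auto_derive. simpl in Ht. lra.
  - intros t _. replace (- (0 ^ 2 * (1 + t ^ 2))) with 0 by ring. rewrite exp_0. apply Rmult_1_l.
Qed.

Lemma gauss_sqr (x : R) : gauss x ^ 2 + gauss_aux x = PI / 4.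
Proof.
  rewrite <- gauss_aux_0. replace (gauss_aux 0) with (gauss 0 ^ 2 + gauss_aux 0) by (rewrite gauss_0; ring).
  destruct (MVT_gen (fun x => gauss x ^ 2 + gauss_aux x) 0 x (fun _ => 0)) as [c [_ Hc]].
  - intros y _. replace 0 with (2 * gauss y * exp (- y ^ 2) + - 2 * exp (- y ^ 2) * gauss y) by ring.
    apply (is_derive_plus (fun x => gauss x ^ 2) gauss_aux); [| apply is_derive_gauss_aux].
    assert (H := is_derive_pow gauss 2 y _ (is_derive_gauss y)). simpl in H.
    replace (2 * gauss y * exp (- y ^ 2)) with ((1 + 1) * exp (- (y * (y * 1))) * (gauss y * 1)) by (simpl; ring).
    exact H.
  - intros y _. apply continuity_pt_filterlim.
    apply (ex_derive_continuous (fun x => gauss x ^ 2 + gauss_aux x)).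
    apply (ex_derive_plus (fun x => gauss x ^ 2) gauss_aux).
    + apply ex_derive_pow. eexists. apply is_derive_gauss.
    + eexists. apply is_derive_gauss_aux.
  - simpl in Hc |- *. lra.
Qed.

Lemma gauss_aux_le (x : R) : 0 <= gauss_aux x <= exp (- x ^ 2).
Proof.
  split.
  - apply RInt_ge_0; [lra | apply ex_RInt_gauss_aux |].
    intros t _. left. apply Rdiv_lt_0_compat; [apply exp_pos | apply one_plus_sqr_pos].
  - apply Rle_trans with (RInt (fun _ => exp (- x ^ 2)) 0 1).
    + apply RInt_le; [lra | apply ex_RInt_gauss_aux | apply ex_RInt_const |].
      intros t _. assert (Ht := one_plus_sqr_pos t). assert (Ht2 := pow2_ge_0 t). assert (Hx := pow2_ge_0 x).
      apply Rmult_le_reg_r with (1 + t ^ 2); [trivial |].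
      replace (exp (- (x ^ 2 * (1 + t ^ 2))) / (1 + t ^ 2) * (1 + t ^ 2)) with (exp (- (x ^ 2 * (1 + t ^ 2)))) by (field; lra).
      apply Rle_trans with (exp (- x ^ 2) * 1); [| apply Rmult_le_compat_l; [left; apply exp_pos | lra]].
      rewrite Rmult_1_r. assert (H : - (x ^ 2 * (1 + t ^ 2)) <= - x ^ 2) by nra.
      destruct H as [H | ->]; [left; now apply exp_increasing | apply Rle_refl].
    + rewrite RInt_const. unfold scal; simpl. unfold mult; simpl. lra.
Qed.

Lemma gauss_ge_0 (x : R) : 0 <= x -> 0 <= gauss x.
Proof.
  intros [H | <-]; [rewrite <- gauss_0; left; now apply gauss_lt | rewrite gauss_0; lra].
Qed.

Lemma gauss_lim : filterlim gauss (Rbar_locally p_infty) (locally (sqrt PI / 2)).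
Proof.
  assert (HE : filterlim (fun x => exp (- x ^ 2)) (Rbar_locally p_infty) (locally 0)).
  { apply (filterlim_squeeze (Rbar_locally p_infty) _ (fun t => exp (0 - 1 * t))); [apply exp_neg_lim; lra |].
    exists 1. intros t Ht. rewrite Rminus_0_r, Rabs_pos_eq by (left; apply exp_pos).
    left. apply exp_increasing. simpl. nra. }
  assert (H : filterlim gauss_aux (Rbar_locally p_infty) (locally 0)).
  { apply (filterlim_squeeze (Rbar_locally p_infty) _ _ _ HE). apply filter_forall. intros x.
    rewrite Rminus_0_r. destruct (gauss_aux_le x). rewrite Rabs_pos_eq; lra. }
  replace (sqrt PI / 2) with (sqrt (PI / 4 - 0)).
  - apply filterlim_ext_loc with (fun x => sqrt (PI / 4 - gauss_aux x)).
    + exists 0. intros x Hx. rewrite <- (gauss_sqr x).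
      replace (gauss x ^ 2 + gauss_aux x - gauss_aux x) with (gauss x ^ 2) by ring.
      apply sqrt_pow2, gauss_ge_0. lra.
    + apply (filterlim_continuous (Rbar_locally p_infty) (fun x => PI / 4 - gauss_aux x) sqrt).
      * apply (filterlim_Rminus (Rbar_locally p_infty)); [apply filterlim_const | exact H].
      * apply continuous_sqrt.
  - rewrite Rminus_0_r, sqrt_div_alt by lra. f_equal. replace 4 with (2 ^ 2) by ring. apply sqrt_pow2. lra.
Qed.

(** The substitution t = u^2, carried out on the primitive. The square root is not differentiable at
    0, but only the limit of the primitive is needed there. *)
Lemma Gamma_half : Gamma (/ 2) = sqrt PI.
Proof.
  apply Gamma_eq. replace (sqrt PI) with (2 * (sqrt PI / 2) - 2 * gauss (sqrt 0)) by (rewrite sqrt_0, gauss_0; field).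
  apply is_RInt_gen_primitive with (fun t => 2 * gauss (sqrt t)).
  - intros t Ht. assert (Hs : 0 < sqrt t) by (now apply sqrt_lt_R0).
    replace (gamma_density (/ 2) t) with (2 * (/ (2 * sqrt t) * exp (- sqrt t ^ 2))).
    + apply is_derive_scal with (f := fun t => gauss (sqrt t)).
      apply (is_derive_comp gauss sqrt); [apply is_derive_gauss |].
      apply is_derive_Reals, derivable_pt_lim_sqrt, Ht.
    + unfold gamma_density. rewrite pow2_sqrt by lra.
      replace (/ 2 - 1) with (- / 2) by field. rewrite Rpower_Ropp, Rpower_sqrt by trivial. field. lra.
  - intros t Ht. now apply continuous_gamma_density.
  - apply (filterlim_filter_le_1 (F := locally 0) (G := at_right 0)).
    + intros P [eps HP]. exists eps. intros y Hy _. now apply HP.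
    + apply (filterlim_Rmult (locally 0)); [apply filterlim_const |].
      apply (filterlim_continuous (locally 0) sqrt gauss); [apply continuous_sqrt |].
      apply (ex_derive_continuous gauss). eexists. apply is_derive_gauss.
  - apply (filterlim_Rmult (Rbar_locally p_infty)); [apply filterlim_const |].
    exact (filterlim_comp _ _ _ _ _ _ _ _ filterlim_sqrt_p gauss_lim).
Qed.

(** * Dominated convergence of Wright series *)

Lemma Series_tail_small (M : nat -> R) (eps : R) :
  ex_series M -> 0 < eps -> exists N, Rabs (Series (fun k => M (S N + k)%nat)) < eps.
Proof.
  intros HM He.
  assert (Hl : is_lim_seq (sum_n M) (Series M)) by (exact (Series_correct M HM)).
  destruct (proj1 (filterlim_Rabs_locally eventually _ _) Hl eps He) as [N HN].
  exists N. specialize (HN N (le_n N)).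
  rewrite (Series_incr_n M (S N)) in HN by (lia || trivial).
  cbn [pred] in HN. rewrite sum_n_Reals in HN.
  rewrite Rabs_minus_sym in HN. ring_simplify (sum_f_R0 M N + Series (fun k => M (S N + k)%nat) - sum_f_R0 M N) in HN.
  exact HN.
Qed.

Lemma Rabs_lim_le {T : Type} (F : (T -> Prop) -> Prop) {FF : ProperFilter F} (f : T -> R) (l M : R) :
  F (fun t => Rabs (f t) <= M) -> filterlim f F (locally l) -> Rabs l <= M.
Proof.
  intros Hb Hl. apply Rnot_lt_le. intros Hlt.
  destruct (filter_ex _ (filter_and _ _ Hb (proj1 (filterlim_Rabs_locally F f l) Hl (Rabs l - M) ltac:(lra)))) as [t [H1 H2]].
  assert (H3 := Rabs_triang_inv l (f t)). rewrite Rabs_minus_sym in H2. lra.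
Qed.

Lemma filterlim_sum_f_R0 {T : Type} (F : (T -> Prop) -> Prop) {FF : Filter F} (f : T -> nat -> R) (g : nat -> R) (N : nat) :
  (forall n, filterlim (fun t => f t n) F (locally (g n))) ->
  filterlim (fun t => sum_f_R0 (f t) N) F (locally (sum_f_R0 g N)).
Proof.
  intros Hl. induction N as [| N IH]; simpl; [apply Hl |].
  now apply (filterlim_Rplus F).
Qed.

(** Dominated convergence for series. The filter is arbitrary because it serves both N -> infinity
    in the positivity proof and alpha -> 1 from the left; [M] also bounds the limit terms, so both
    tails are controlled at once. *)
Lemma tannery {T : Type} (F : (T -> Prop) -> Prop) {FF : ProperFilter F} (f : T -> nat -> R) (g M : nat -> R) :
  ex_series M -> F (fun t => forall n, Rabs (f t n) <= M n) ->
  (forall n, filterlim (fun t => f t n) F (locally (g n))) ->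
  filterlim (fun t => Series (f t)) F (locally (Series g)).
Proof.
  intros HM Hb Hl.
  assert (Hg : forall n, Rabs (g n) <= M n).
  { intros n. apply (Rabs_lim_le F (fun t => f t n)); [| apply Hl].
    revert Hb. apply filter_imp. intros t Ht. apply Ht. }
  assert (Htail : forall h N, (forall n, Rabs (h n) <= M n) ->
    ex_series h /\ Rabs (Series (fun k => h (S N + k)%nat)) <= Series (fun k => M (S N + k)%nat)).
  { intros h N Hh. split.
    - now apply (ex_series_le h M).
    - assert (HMN : ex_series (fun k => M (S N + k)%nat)) by (now apply ex_series_incr_n).
      apply Rle_trans with (Series (fun k => Rabs (h (S N + k)%nat))).
      + apply Series_Rabs. apply (ex_series_le (fun k => Rabs (h (S N + k)%nat)) (fun k => M (S N + k)%nat)); trivial.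
        intros n. unfold norm; simpl. unfold abs; simpl. rewrite Rabs_Rabsolu. apply Hh.
      + apply Series_le; trivial. intros n. split; [apply Rabs_pos | apply Hh]. }
  apply (filterlim_Rabs_locally F). intros eps He.
  destruct (Series_tail_small M (eps / 3) HM ltac:(lra)) as [N HN].
  assert (Hs := proj1 (filterlim_Rabs_locally F _ _) (filterlim_sum_f_R0 F f g N Hl) (eps / 3) ltac:(lra)).
  generalize (filter_and _ _ Hb Hs). apply filter_imp. intros t [H1 H2].
  destruct (Htail (f t) N H1) as [E1 T1]. destruct (Htail g N Hg) as [E2 T2].
  rewrite (Series_incr_n (f t) (S N)), (Series_incr_n g (S N)) by (lia || trivial). cbn [pred].
  apply Rabs_def2 in HN. apply Rabs_def2 in H2.
  apply Rabs_le_between in T1. apply Rabs_le_between in T2. apply Rabs_def1; lra.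
Qed.

(** * Bounds on Euler products uniform in N *)

Fixpoint harmonic (n : nat) : R :=
  match n with
  | O => 0
  | S m => harmonic m + / INR (S m)
  end.

Lemma INR_S_pos (n : nat) : 0 < INR (S n).
Proof. apply lt_0_INR. lia. Qed.

Lemma harmonic_le_mono (m n : nat) : (m <= n)%nat -> harmonic m <= harmonic n.
Proof.
  induction 1 as [| n _ IH]; [lra |]. cbn [harmonic].
  generalize (Rinv_0_lt_compat _ (INR_S_pos n)). lra.
Qed.

(** This comparison absorbs the factor N^s of [euler_gamma]; the opposite one, [harmonic_le_ln],
    serves the ratio test for the majorant. *)
Lemma ln_le_harmonic (n : nat) : ln (INR (S n)) <= harmonic n.
Proof.
  induction n as [| n IH]; [simpl; rewrite ln_1; lra |].
  cbn [harmonic]. assert (Hn := INR_S_pos n).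
  assert (H : ln (INR (S (S n))) - ln (INR (S n)) <= / INR (S n)).
  { rewrite <- ln_div by apply INR_S_pos. eapply Rle_trans.
    - apply ln_le_sub, Rdiv_lt_0_compat; apply INR_S_pos.
    - rewrite (S_INR (S n)). right. field. lra. }
  lra.
Qed.

Lemma harmonic_le_ln (n : nat) : harmonic (S n) <= 1 + ln (INR (S n)).
Proof.
  induction n as [| n IH]; [simpl; rewrite ln_1, Rinv_1; lra |].
  cbn [harmonic] in *. assert (Hn := INR_S_pos n). assert (Hn2 := INR_S_pos (S n)).
  assert (H : ln (INR (S n)) - ln (INR (S (S n))) <= - / INR (S (S n))).
  { rewrite <- ln_div by trivial. eapply Rle_trans.
    - apply ln_le_sub, Rdiv_lt_0_compat; trivial.
    - rewrite (S_INR (S n)) in *. right. field. lra. }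
  lra.
Qed.

Lemma exp_le_exp (x y : R) : x <= y -> exp x <= exp y.
Proof. intros [H | ->]; [left; now apply exp_increasing | apply Rle_refl]. Qed.

(** Squaring 1 + u/4 <= exp(u/4) suffices, as (1 + u/4)^2 exceeds u - 1 everywhere. A rate below 1
    in the exponent is essential: exp(u) would lead to growth of order n^n, too fast for 1/n!. *)
Lemma Rabs_1_minus_le_exp (u : R) : 0 <= u -> Rabs (1 - u) <= exp (u / 2).
Proof.
  intros Hu. assert (H1 := exp_ineq1_le (u / 2)).
  assert (H2 := exp_ineq1_le (u / 4)).
  assert (H3 : exp (u / 2) = exp (u / 4) * exp (u / 4)) by (rewrite <- exp_plus; f_equal; field).
  apply Rabs_le. nra.
Qed.

(** Factors with i > n >= s lie in [0,1] and are at most exp(-s/i). The earlier ones may be large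
    and negative, and are bounded by exp(s/(2i)) = exp(-s/i + (3/2) s/i), which explains the 3/2 and
    the truncation at [min N n]. *)
Lemma euler_prod_le (n N : nat) (s : R) : 0 <= s <= INR n ->
  Rabs (euler_prod N s) <= exp (- s * harmonic N + 3 / 2 * s * harmonic (min N n)).
Proof.
  intros Hs. induction N as [| N IH].
  - simpl. rewrite Rabs_R1, !Rmult_0_r, Rplus_0_r, exp_0. lra.
  - cbn [euler_prod]. assert (HN := INR_S_pos N). assert (HNi := Rinv_0_lt_compat _ HN).
    assert (Hu : 0 <= s / INR (S N)) by (apply Rmult_le_pos; lra).
    rewrite Rabs_mult. destruct (Nat.le_gt_cases (S N) n) as [H | H].
    + rewrite Nat.min_l in IH |- * by lia. cbn [harmonic].
      replace (- s * (harmonic N + / INR (S N)) + 3 / 2 * s * (harmonic N + / INR (S N))) with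
        (- s * harmonic N + 3 / 2 * s * harmonic N + s / INR (S N) / 2) by (field; lra).
      rewrite exp_plus. apply Rmult_le_compat; try apply Rabs_pos; [exact IH | now apply Rabs_1_minus_le_exp].
    + rewrite Nat.min_r in IH |- * by lia. cbn [harmonic].
      replace (- s * (harmonic N + / INR (S N)) + 3 / 2 * s * harmonic n) with
        (- s * harmonic N + 3 / 2 * s * harmonic n + - (s / INR (S N))) by (field; lra).
      rewrite exp_plus. apply Rmult_le_compat; try apply Rabs_pos; [exact IH |].
      assert (s / INR (S N) <= 1).
      { apply Rmult_le_reg_r with (INR (S N)); [trivial |]. unfold Rdiv.
        rewrite Rmult_assoc, Rinv_l, Rmult_1_r by lra. apply lt_INR in H. lra. }
      rewrite Rabs_pos_eq by lra. generalize (exp_ineq1_le (- (s / INR (S N)))). lra.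
Qed.

(* Grows like [n^(3n/4)], hence slowly enough to be beaten by [1/n!]. *)
Definition euler_bound (n : nat) : R := exp (3 / 4 * INR n * harmonic n).

Lemma harmonic_ge_0 (n : nat) : 0 <= harmonic n.
Proof. apply (harmonic_le_mono 0 n). lia. Qed.

(** The range of [s] is that of n nu with nu <= 1/2. The factor exp(-s H_N) is kept because it
    cancels N^s in [euler_gamma_bound]. *)
Lemma euler_prod_le_bound (n N : nat) (s : R) : 0 <= s <= INR n / 2 ->
  Rabs (euler_prod N s) <= exp (- s * harmonic N) * euler_bound n.
Proof.
  intros Hs. assert (Hn := pos_INR n).
  eapply Rle_trans; [apply (euler_prod_le n); lra |].
  unfold euler_bound. rewrite <- exp_plus. apply exp_le_exp.
  assert (H1 := harmonic_le_mono (min N n) n (Nat.le_min_r N n)).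
  assert (H2 := harmonic_ge_0 (min N n)). assert (H3 := harmonic_ge_0 n). nra.
Qed.

Lemma euler_prod_bound (n N : nat) (s : R) : 0 <= s <= INR n / 2 -> Rabs (euler_prod N s) <= euler_bound n.
Proof.
  intros Hs. eapply Rle_trans; [apply (euler_prod_le_bound n); trivial |].
  rewrite <- (Rmult_1_l (euler_bound n)) at 2. apply Rmult_le_compat_r; [left; apply exp_pos |].
  rewrite <- exp_0. apply exp_le_exp. assert (H := harmonic_ge_0 N). nra.
Qed.

Lemma euler_gamma_bound (n N : nat) (s : R) : 0 <= s <= INR n / 2 ->
  Rabs (euler_gamma (S N) s) <= euler_bound n.
Proof.
  intros Hs. unfold euler_gamma. rewrite Rabs_mult, (Rabs_pos_eq (Rpower _ _)) by (left; apply exp_pos).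
  apply Rle_trans with (Rpower (INR (S N)) s * (exp (- s * harmonic (S N)) * euler_bound n)).
  - apply Rmult_le_compat_l; [left; apply exp_pos | now apply euler_prod_le_bound].
  - rewrite <- Rmult_assoc. rewrite <- (Rmult_1_l (euler_bound n)) at 2.
    apply Rmult_le_compat_r; [left; apply exp_pos |].
    unfold Rpower. rewrite <- exp_plus, <- exp_0. apply exp_le_exp.
    assert (H := ln_le_harmonic N). assert (H1 := harmonic_le_mono N (S N) ltac:(lia)). nra.
Qed.

Lemma rgamma_bound (n : nat) (s : R) : 0 <= s <= INR n / 2 -> Rabs (rgamma (1 - s)) <= euler_bound n.
Proof.
  intros Hs. apply (Rabs_lim_le eventually (fun N => euler_gamma (S N) s)).
  - apply filter_forall. intros N. now apply euler_gamma_bound.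
  - apply (proj1 (is_lim_seq_incr_1 (fun N => euler_gamma N s) (rgamma (1 - s)))), euler_gamma_lim. lra.
Qed.

(** The shift to [S n] is for the Mainardi coefficients 1/Gamma(1 - (n+1) nu); the Wright ones fit
    through [euler_bound_le_S]. *)
Definition wright_majorant (X : R) (n : nat) : R := X ^ n / INR (fact n) * euler_bound (S n).

Lemma ex_series_wright_majorant (X : R) : 0 < X -> ex_series (wright_majorant X).
Proof.
  intros HX.
  assert (Hpos : forall n, 0 < wright_majorant X n).
  { intros n. apply Rmult_lt_0_compat; [| apply exp_pos].
    apply Rdiv_lt_0_compat; [now apply pow_lt | apply INR_fact_lt_0]. }
  apply ex_series_ext with (fun n => Rabs (wright_majorant X n)).
  { intros n. apply Rabs_pos_eq. left. apply Hpos. }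
  apply ex_series_DAlembert with 0; [lra | intros n; apply Rgt_not_eq, Hpos |].
  (* As (m+1) H_{m+1} - m H_m = H_m + 1, the ratio of consecutive terms is X exp(3/4 (H_m + 1))/m
     with m = [S n]. Inserting H_m <= 1 + ln m leaves m^(-1/4) up to a constant. *)
  apply (filterlim_squeeze eventually _ (fun n => X * exp (3 / 2 - 1 / 4 * ln (INR (S n))))).
  - rewrite <- (Rmult_0_r X). apply (filterlim_Rmult eventually); [apply filterlim_const |].
    assert (Hln : filterlim (fun n => ln (INR (S n))) eventually (Rbar_locally p_infty)).
    { apply (filterlim_comp _ _ _ (fun n => INR (S n)) ln eventually (Rbar_locally p_infty)).
      - apply (proj1 (is_lim_seq_incr_1 INR p_infty)), is_lim_seq_INR.
      - apply is_lim_ln_p. }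
    apply (filterlim_comp _ _ _ _ (fun t => exp (3 / 2 - 1 / 4 * t)) eventually (Rbar_locally p_infty) _ Hln).
    apply exp_neg_lim. lra.
  - apply filter_forall. intros n. rewrite Rminus_0_r, Rabs_Rabsolu.
    rewrite Rabs_pos_eq by (left; apply Rdiv_lt_0_compat; apply Hpos).
    assert (Hn := INR_S_pos n). assert (Hf := INR_fact_lt_0 n). assert (HXn := pow_lt X n HX).
    unfold wright_majorant, euler_bound.
    replace (3 / 4 * INR (S (S n)) * harmonic (S (S n))) with
      (3 / 4 * INR (S n) * harmonic (S n) + 3 / 4 * (harmonic (S n) + 1)).
    2: { cbn [harmonic]. rewrite (S_INR (S n)). field. lra. }
    rewrite exp_plus, fact_simpl, mult_INR. cbn [pow].
    set (E := exp (3 / 4 * INR (S n) * harmonic (S n))).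
    assert (HE : 0 < E) by apply exp_pos.
    replace (X * X ^ n / (INR (S n) * INR (fact n)) * (E * exp (3 / 4 * (harmonic (S n) + 1))) / (X ^ n / INR (fact n) * E))
      with (X * (exp (3 / 4 * (harmonic (S n) + 1)) * / INR (S n))) by (field; lra).
    apply Rmult_le_compat_l; [lra |].
    replace (/ INR (S n)) with (exp (- ln (INR (S n)))) by (rewrite exp_Ropp, exp_ln; trivial).
    rewrite <- exp_plus. apply exp_le_exp. assert (H := harmonic_le_ln n). lra.
Qed.

Lemma wright_majorant_le (X x : R) (c : R) (n : nat) :
  Rabs x <= X -> Rabs c <= euler_bound (S n) -> Rabs (x ^ n / INR (fact n) * c) <= wright_majorant X n.
Proof.
  intros Hx Hc. unfold wright_majorant. rewrite Rabs_mult. apply Rmult_le_compat; try apply Rabs_pos; [| exact Hc].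
  unfold Rdiv. rewrite Rabs_mult, <- RPow_abs, (Rabs_pos_eq (/ _)).
  - apply Rmult_le_compat_r; [left; apply Rinv_0_lt_compat, INR_fact_lt_0 |].
    apply pow_incr. split; [apply Rabs_pos | exact Hx].
  - left. apply Rinv_0_lt_compat, INR_fact_lt_0.
Qed.

(** Absolute convergence at |x| + 1 pushes the radius strictly past |x|. *)
Lemma CV_radius_wright (c : nat -> R) (x : R) :
  (forall n, Rabs (c n) <= euler_bound (S n)) ->
  Rbar_lt (Rabs x) (CV_radius (fun n => c n / INR (fact n))).
Proof.
  intros Hc. apply Rbar_lt_le_trans with (Finite (Rabs x + 1)); [simpl; lra |].
  apply (proj1 (Lub_Rbar_correct (CV_disk (fun n => c n / INR (fact n))))).
  assert (H0 := Rabs_pos x).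
  apply (ex_series_le (fun n => Rabs (c n / INR (fact n) * (Rabs x + 1) ^ n)) (wright_majorant (Rabs x + 1)));
    [| apply ex_series_wright_majorant; lra].
  intros n. unfold norm; simpl. unfold abs; simpl. rewrite Rabs_Rabsolu.
  replace (c n / INR (fact n) * (Rabs x + 1) ^ n) with ((Rabs x + 1) ^ n / INR (fact n) * c n)
    by (field; apply INR_fact_neq_0).
  apply wright_majorant_le; [rewrite Rabs_pos_eq; lra | apply Hc].
Qed.

Lemma euler_bound_le_S (n : nat) : euler_bound n <= euler_bound (S n).
Proof.
  apply exp_le_exp. assert (H := pos_INR n). assert (H1 := harmonic_ge_0 n).
  assert (H2 := harmonic_le_mono n (S n) ltac:(lia)). rewrite S_INR. nra.
Qed.

(** * Positivity of the Mainardi function *)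

(** Common form of W(-x; -nu, 1), M_nu(x) and their Euler truncations. Differentiation shifts [c] by
    one and changes the sign. *)
Definition exp_gf (c : nat -> R) (x : R) : R := PSeries (fun n => c n / INR (fact n)) (- x).

Lemma exp_gf_Series (c : nat -> R) (x : R) : exp_gf c x = Series (fun n => (- x) ^ n / INR (fact n) * c n).
Proof.
  apply Series_ext. intros n. field. apply INR_fact_neq_0.
Qed.

Lemma exp_gf_ext (c d : nat -> R) (x : R) : (forall n, c n = d n) -> exp_gf c x = exp_gf d x.
Proof. intros H. apply PSeries_ext. intros n. now rewrite H. Qed.

Lemma exp_gf_0 (c : nat -> R) : exp_gf c 0 = c O.
Proof. unfold exp_gf. rewrite Ropp_0, PSeries_0. simpl. field. Qed.

Lemma ex_series_exp_gf (c : nat -> R) (x : R) : (forall n, Rabs (c n) <= euler_bound (S n)) ->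
  ex_series (fun n => (- x) ^ n / INR (fact n) * c n).
Proof.
  intros Hc. apply (ex_series_le (fun n => (- x) ^ n / INR (fact n) * c n) (wright_majorant (Rabs x + 1))).
  - intros n. apply wright_majorant_le; [rewrite Rabs_Ropp; lra | apply Hc].
  - apply ex_series_wright_majorant. generalize (Rabs_pos x). lra.
Qed.

Lemma is_derive_exp_gf (c : nat -> R) (x : R) : (forall n, Rabs (c n) <= euler_bound (S n)) ->
  is_derive (exp_gf c) x (- exp_gf (fun n => c (S n)) x).
Proof.
  intros Hc. unfold exp_gf.
  assert (H := is_derive_PSeries _ (- x) (CV_radius_wright c (- x) Hc)).
  assert (H1 := is_derive_comp _ Ropp x _ (-1) H ltac:(auto_derive; trivial; ring)).
  replace (- PSeries (fun n => c (S n) / INR (fact n)) (- x)) with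
    (scal (-1) (PSeries (PS_derive (fun n => c n / INR (fact n))) (- x))); [exact H1 |].
  rewrite (PSeries_ext (PS_derive _) (fun n => c (S n) / INR (fact n))).
  - unfold scal; simpl. unfold mult; simpl. ring.
  - intros n. unfold PS_derive. rewrite fact_simpl, mult_INR. field.
    split; [apply INR_fact_neq_0 | apply not_0_INR; lia].
Qed.

Lemma exp_gf_sum (c : nat -> nat -> R) (x : R) (N : nat) :
  (forall k, (k <= N)%nat -> ex_series (fun n => (- x) ^ n / INR (fact n) * c k n)) ->
  exp_gf (fun n => sum_f_R0 (fun k => c k n) N) x = sum_f_R0 (fun k => exp_gf (c k) x) N /\
  ex_series (fun n => (- x) ^ n / INR (fact n) * sum_f_R0 (fun k => c k n) N).
Proof.
  induction N as [| N IH]; intros Hex; simpl; [split; [reflexivity | now apply (Hex O)] |].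
  destruct IH as [IH1 IH2]; [intros k Hk; apply Hex; lia |].
  assert (HexS := Hex (S N) (le_n _)).
  assert (Heq : forall n, (- x) ^ n / INR (fact n) * (sum_f_R0 (fun k => c k n) N + c (S N) n) =
    (- x) ^ n / INR (fact n) * sum_f_R0 (fun k => c k n) N + (- x) ^ n / INR (fact n) * c (S N) n) by (intros n; ring).
  split.
  - rewrite <- IH1, !exp_gf_Series, <- Series_plus by trivial. now apply Series_ext.
  - apply ex_series_ext with (2 := ex_series_plus _ _ IH2 HexS).
    intros n. symmetry. apply Heq.
Qed.

Lemma euler_prod_rec (N : nat) (s : R) :
  INR (S N) * euler_prod (S N) s = (INR (S N) - s) * euler_prod N s.
Proof. cbn [euler_prod]. field. apply not_0_INR. lia. Qed.

(* Chu-Vandermonde: [euler_prod N s] is the coefficient of [z^N] in [(1 - z)^(s - 1)]. *)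
Lemma euler_prod_plus (N : nat) (s t : R) :
  euler_prod N (s + t) = sum_f_R0 (fun k => euler_prod k (t + 1) * euler_prod (N - k) s) N.
Proof.
  induction N as [| N IH]; [simpl; ring |].
  assert (HN := INR_S_pos N).
  apply Rmult_eq_reg_l with (INR (S N)); [| lra].
  rewrite euler_prod_rec, IH, !scal_sum.
  (* Split the weight N + 1 as k + (N + 1 - k), so that each half lowers one of the two factors by
     its own recurrence. The two multipliers then add up to N + 1 - s - t, independent of k. *)
  rewrite (sum_eq _ (fun k => INR k * euler_prod k (t + 1) * euler_prod (S N - k) s +
    euler_prod k (t + 1) * (INR (S N - k) * euler_prod (S N - k) s)) (S N)).
  2: { intros k Hk. rewrite minus_INR by trivial. ring. }
  rewrite sum_plus, (decomp_sum _ (S N)), (tech5 (fun k => euler_prod k (t + 1) * (INR (S N - k) * _)) N) by lia.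
  cbn [pred]. rewrite Nat.sub_diag. change (INR 0) with 0. rewrite !Rmult_0_l, Rmult_0_r, Rplus_0_l, Rplus_0_r.
  rewrite <- sum_plus. apply sum_eq. intros k Hk.
  rewrite euler_prod_rec. replace (S N - k)%nat with (S (N - k)) by lia. rewrite euler_prod_rec.
  replace (S N - S k)%nat with (N - k)%nat by lia.
  rewrite (S_INR (N - k)), minus_INR, !S_INR by trivial. ring.
Qed.

Lemma euler_prod_ge_0 (N : nat) (s : R) : 0 <= s <= 1 -> 0 <= euler_prod N s.
Proof.
  intros Hs. induction N as [| N IH]; cbn [euler_prod]; [lra |].
  apply Rmult_le_pos; [exact IH |].
  assert (HN := INR_S_pos N). assert (H1 : 1 <= INR (S N)) by (rewrite S_INR; generalize (pos_INR N); lra).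
  assert (s / INR (S N) <= 1); [| lra].
  apply Rmult_le_reg_r with (INR (S N)); [trivial |]. unfold Rdiv. rewrite Rmult_assoc, Rinv_l; lra.
Qed.

(** These are the nonconstant coefficients of (1-z)^s. The factor at i = 1 equals -s, and all later
    ones are nonnegative because s + 1 <= 2. *)
Lemma euler_prod_shift_le_0 (N : nat) (s : R) : 0 <= s <= 1 -> euler_prod (S N) (s + 1) <= 0.
Proof.
  intros Hs. induction N as [| N IH].
  - simpl. rewrite Rdiv_1_r. lra.
  - set (n := S N) in *. cbn [euler_prod].
    assert (H2 : 2 <= INR (S n)) by (unfold n; rewrite !S_INR; generalize (pos_INR N); lra).
    assert ((s + 1) / INR (S n) <= 1).
    { apply Rmult_le_reg_r with (INR (S n)); [lra |]. unfold Rdiv. rewrite Rmult_assoc, Rinv_l; lra. }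
    nra.
Qed.

(* [euler_gf nu N y] is the coefficient of [z^N] in [exp(-y (1-z)^nu) (1-z)^(nu-1)]. *)
Definition euler_gf (nu : R) (N : nat) : R -> R := exp_gf (fun n => euler_prod N (INR (S n) * nu)).

Lemma index_bound (nu : R) (n : nat) : 0 < nu <= / 2 -> 0 <= INR n * nu <= INR n / 2.
Proof. intros Hnu. assert (H := pos_INR n). split; [nra |]. unfold Rdiv. apply Rmult_le_compat_l; lra. Qed.

(** Differentiating exp(-y (1-z)^nu) in y multiplies it by -(1-z)^nu, whose coefficients are
    [- euler_prod k (nu + 1)]. On coefficients this is a convolution, supplied by [euler_prod_plus]
    with [t = nu]. *)
Lemma is_derive_euler_gf (nu : R) (N : nat) (y : R) : 0 < nu <= / 2 ->
  is_derive (euler_gf nu N) y (- sum_f_R0 (fun k => euler_prod k (nu + 1) * euler_gf nu (N - k) y) N).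
Proof.
  intros Hnu.
  assert (Hb : forall M n, Rabs (euler_prod M (INR (S n) * nu)) <= euler_bound (S n)).
  { intros M n. apply euler_prod_bound. now apply index_bound. }
  replace (sum_f_R0 (fun k => euler_prod k (nu + 1) * euler_gf nu (N - k) y) N) with
    (exp_gf (fun n => euler_prod N (INR (S (S n)) * nu)) y).
  - apply (is_derive_exp_gf (fun n => euler_prod N (INR (S n) * nu))). apply Hb.
  - rewrite (exp_gf_ext _ (fun n => sum_f_R0 (fun k => euler_prod k (nu + 1) * euler_prod (N - k) (INR (S n) * nu)) N)).
    + rewrite (fun H => proj1 (exp_gf_sum (fun k n => euler_prod k (nu + 1) * euler_prod (N - k) (INR (S n) * nu)) y N H)).
      * apply sum_eq. intros k _. unfold euler_gf. rewrite !exp_gf_Series, <- Series_scal_l.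
        apply Series_ext. intros n. ring.
      * intros k _.
        apply ex_series_ext with (2 := ex_series_scal_l (euler_prod k (nu + 1)) _
          (ex_series_exp_gf (fun n => euler_prod (N - k) (INR (S n) * nu)) y (Hb (N - k)%nat))).
        intros n. unfold scal; simpl. unfold mult; simpl. ring.
    + intros n. rewrite <- euler_prod_plus. f_equal. rewrite (S_INR (S n)). ring.
Qed.

(* [exp y * euler_gf nu N y] has derivative [exp y * sum_{1<=k<=N} p_k * euler_gf nu (N-k) y],
   where the [p_k >= 0] are the coefficients of [1 - (1 - z)^nu]. *)
Lemma euler_gf_ge_0 (nu : R) (N : nat) (y : R) : 0 < nu <= / 2 -> 0 <= y -> 0 <= euler_gf nu N y.
Proof.
  intros Hnu. revert y. induction N as [N IH] using (well_founded_induction Wf_nat.lt_wf). intros y Hy.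
  set (df := fun y => exp y * euler_gf nu N y +
    exp y * - sum_f_R0 (fun k => euler_prod k (nu + 1) * euler_gf nu (N - k) y) N).
  assert (Hd : forall y, is_derive (fun y => exp y * euler_gf nu N y) y (df y)).
  { intros z. apply (is_derive_mult exp (euler_gf nu N)).
    - apply is_derive_Reals, derivable_pt_lim_exp.
    - now apply is_derive_euler_gf.
    - intros a b. apply Rmult_comm. }
  assert (Hdf : forall y, 0 <= y -> 0 <= df y).
  { intros z Hz. unfold df. rewrite <- Rmult_plus_distr_l. apply Rmult_le_pos; [left; apply exp_pos |].
    destruct N as [| M].
    - simpl. lra.
    (* The term k = 0 is [euler_gf nu N z] itself and cancels the contribution of the derivative of
       [exp]. *)
    - rewrite decomp_sum by lia. cbn [pred]. rewrite Nat.sub_0_r. simpl (euler_prod 0 _).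
      assert (H : 0 <= sum_f_R0 (fun i => - (euler_prod (S i) (nu + 1) * euler_gf nu (S M - S i) z)) M).
      { apply cond_pos_sum. intros i.
        assert (H1 := euler_prod_shift_le_0 i nu ltac:(lra)).
        assert (H2 := IH (S M - S i)%nat ltac:(lia) z Hz). nra. }
      rewrite (sum_eq _ (fun i => (euler_prod (S i) (nu + 1) * euler_gf nu (S M - S i) z) * -1)) in H by (intros; ring).
      rewrite <- scal_sum in H. lra. }
  assert (H0 : 0 <= exp 0 * euler_gf nu N 0).
  { rewrite exp_0, Rmult_1_l. unfold euler_gf. rewrite exp_gf_0. simpl. apply euler_prod_ge_0. lra. }
  destruct (MVT_gen (fun y => exp y * euler_gf nu N y) 0 y df) as [z [Hz Heq]].
  - intros z _. apply Hd.
  - intros z _. apply continuity_pt_filterlim.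
    apply (ex_derive_continuous (fun y => exp y * euler_gf nu N y)). eexists. apply Hd.
  - rewrite Rmin_left in Hz by trivial. assert (H1 := Hdf z (proj1 Hz)).
    assert (H2 := exp_pos y). assert (0 <= exp y * euler_gf nu N y) by nra. nra.
Qed.

Lemma Wright_exp_gf (x nu b : R) : Wright (- x) (- nu) b = exp_gf (fun n => rgamma (b - INR n * nu)) x.
Proof.
  rewrite exp_gf_Series. apply Series_ext. intros n. do 2 f_equal. ring.
Qed.

Lemma Mainardi_exp_gf (nu x : R) : Mainardi nu x = exp_gf (fun n => rgamma (1 - INR (S n) * nu)) x.
Proof.
  unfold Mainardi. rewrite Wright_exp_gf. apply exp_gf_ext. intros n. f_equal. rewrite S_INR. ring.
Qed.

Lemma rgamma_Mainardi_bound (nu : R) (n : nat) : 0 < nu <= / 2 ->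
  Rabs (rgamma (1 - INR (S n) * nu)) <= euler_bound (S n).
Proof. intros Hnu. apply rgamma_bound. now apply index_bound. Qed.

Lemma rgamma_Wright_bound (nu : R) (n : nat) : 0 < nu <= / 2 ->
  Rabs (rgamma (1 - INR n * nu)) <= euler_bound (S n).
Proof.
  intros Hnu. apply Rle_trans with (2 := euler_bound_le_S n). apply rgamma_bound. now apply index_bound.
Qed.

Lemma Mainardi_ge_0 (nu x : R) : 0 < nu <= / 2 -> 0 <= x -> 0 <= Mainardi nu x.
Proof.
  intros Hnu Hx.
  assert (Hl : filterlim (fun N => Series (fun n => (- x) ^ n / INR (fact n) * euler_gamma (S N) (INR (S n) * nu)))
    eventually (locally (Mainardi nu x))).
  { rewrite Mainardi_exp_gf, exp_gf_Series.
    apply (tannery eventually) with (wright_majorant (Rabs x + 1)).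
    - apply ex_series_wright_majorant. generalize (Rabs_pos x). lra.
    - apply filter_forall. intros N n. apply wright_majorant_le; [rewrite Rabs_Ropp; lra |].
      apply euler_gamma_bound. now apply index_bound.
    - intros n. apply (filterlim_Rmult eventually); [apply filterlim_const |].
      apply (proj1 (is_lim_seq_incr_1 (fun N => euler_gamma N (INR (S n) * nu)) (rgamma (1 - INR (S n) * nu)))).
      apply euler_gamma_lim. now apply (index_bound nu (S n)). }
  apply (filterlim_le (F := eventually) (fun _ => 0) _ (Finite 0) (Finite (Mainardi nu x))) with (3 := Hl).
  - apply filter_forall. intros N. set (M := INR (S N)).
    (* The power M^((n+1) nu) splits as M^nu (M^nu)^n, and the second part is absorbed into the
       argument of the series. *)
    rewrite (Series_ext _ (fun n => Rpower M nu * ((- (x * Rpower M nu)) ^ n / INR (fact n) * euler_prod (S N) (INR (S n) * nu)))).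
    + rewrite Series_scal_l, <- exp_gf_Series. apply Rmult_le_pos; [left; apply exp_pos |].
      apply euler_gf_ge_0; [exact Hnu |]. apply Rmult_le_pos; [exact Hx | left; apply exp_pos].
    + intros n. unfold euler_gamma. fold M.
      replace (Rpower M (INR (S n) * nu)) with (Rpower M nu * Rpower M nu ^ n).
      * replace (- (x * Rpower M nu)) with (- x * Rpower M nu) by ring. rewrite Rpow_mult_distr.
        field. apply INR_fact_neq_0.
      * rewrite <- Rpower_pow, Rpower_mult, <- Rpower_plus by apply exp_pos. f_equal. rewrite S_INR. ring.
  - apply filterlim_const.
Qed.

Definition Wright_cdf (nu x : R) : R := 1 - Wright (- x) (- nu) 1.

Lemma is_derive_Wright_cdf (nu x : R) : 0 < nu <= / 2 -> is_derive (Wright_cdf nu) x (Mainardi nu x).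
Proof.
  intros Hnu. rewrite Mainardi_exp_gf.
  apply (is_derive_ext (fun x => 1 - exp_gf (fun n => rgamma (1 - INR n * nu)) x)).
  - intros y. unfold Wright_cdf. now rewrite Wright_exp_gf.
  - replace (exp_gf (fun n => rgamma (1 - INR (S n) * nu)) x) with
      (0 - - exp_gf (fun n => rgamma (1 - INR (S n) * nu)) x) by ring.
    apply (is_derive_minus (fun _ => 1) (exp_gf (fun n => rgamma (1 - INR n * nu)))).
    + exact (is_derive_const 1 x).
    + apply (is_derive_exp_gf (fun n => rgamma (1 - INR n * nu))). intros n. now apply rgamma_Wright_bound.
Qed.

Lemma Wright_cdf_le (nu x y : R) : 0 < nu <= / 2 -> 0 <= x -> x <= y -> Wright_cdf nu x <= Wright_cdf nu y.
Proof.
  intros Hnu Hx Hxy.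
  destruct (MVT_gen (Wright_cdf nu) x y (Mainardi nu)) as [z [Hz Heq]].
  - intros z _. now apply is_derive_Wright_cdf.
  - intros z _. apply continuity_pt_filterlim. apply (ex_derive_continuous (Wright_cdf nu)).
    eexists. now apply is_derive_Wright_cdf.
  - rewrite Rmin_left in Hz by trivial. assert (H := Mainardi_ge_0 nu z Hnu ltac:(lra)). nra.
Qed.

(** * The limit nu -> 1/2 *)

Lemma eq_of_is_derive (f g df : R -> R) (x : R) :
  (forall y, is_derive f y (df y)) -> (forall y, is_derive g y (df y)) -> f 0 = g 0 -> f x = g x.
Proof.
  intros Hf Hg H0.
  assert (Hd : forall y, is_derive (fun y => f y - g y) y 0).
  { intros y. replace 0 with (df y - df y) by ring. now apply (is_derive_minus f g). }
  destruct (MVT_gen (fun y => f y - g y) 0 x (fun _ => 0)) as [z [_ Heq]].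
  - intros y _. apply Hd.
  - intros y _. apply continuity_pt_filterlim. apply (ex_derive_continuous (fun y => f y - g y)).
    eexists. apply Hd.
  - lra.
Qed.

Lemma rgamma_half : rgamma (/ 2) = / sqrt PI.
Proof. rewrite rgamma_pos, Gamma_half by lra. reflexivity. Qed.

Lemma rgamma_1 : rgamma 1 = 1.
Proof. rewrite rgamma_pos, Gamma_1, Rinv_1 by lra. reflexivity. Qed.

(** At nu = 1/2 two steps in n lower the argument of 1/Gamma by one, giving c_{n+2} = -((n+1)/2)
    c_n. For the series f this means f' = -(x/2) f with f(0) = 1/Gamma(1/2), solved with the
    integrating factor exp(x^2/4). *)
Lemma Mainardi_half (x : R) : Mainardi (1 / 2) x = / sqrt PI * exp (- (x / 2) ^ 2).
Proof.
  rewrite Mainardi_exp_gf.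
  set (c := fun n => rgamma (1 - INR (S n) * (1 / 2))).
  assert (Hc : forall n, Rabs (c n) <= euler_bound (S n)) by (intros n; apply rgamma_Mainardi_bound; lra).
  assert (Hc2 : forall n, c (S (S n)) = - (INR (S n) / 2) * c n).
  { intros n. unfold c. rewrite rgamma_step.
    replace (1 - INR (S (S (S n))) * (1 / 2) + 1) with (1 - INR (S n) * (1 / 2)) by (rewrite !S_INR; field).
    f_equal. rewrite !S_INR. field. }
  assert (Hode : forall y, exp_gf (fun n => c (S n)) y = y / 2 * exp_gf c y).
  { intros y. rewrite !exp_gf_Series, <- Series_scal_l, Series_incr_1.
    (* The leading coefficient of the shifted series is 1/Gamma(0) = 0. Dropping it aligns index n +
       2 on one side with n on the other. *)
    - replace (c 1%nat) with 0.
      + rewrite Rmult_0_r, Rplus_0_l. apply Series_ext. intros n.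
        rewrite Hc2, fact_simpl, mult_INR. cbn [pow]. field.
        split; [apply INR_fact_neq_0 | apply not_0_INR; lia].
      + assert (E : 1 - INR 2 * (1 / 2) = 0) by (simpl; field).
        unfold c. rewrite E. symmetry. exact rgamma_0.
    - apply (ex_series_incr_1 (fun n => (- y) ^ n / INR (fact n) * c (S n))).
      apply (ex_series_ext (fun n => y / 2 * ((- y) ^ n / INR (fact n) * c n))).
      + intros n. rewrite Hc2, fact_simpl, mult_INR. cbn [pow].
        match goal with |- ?a = ?b => change (a = b :> R) end. field.
        split; [apply INR_fact_neq_0 | apply not_0_INR; lia].
      + apply (ex_series_scal_l (y / 2) (fun n => (- y) ^ n / INR (fact n) * c n)).
        now apply ex_series_exp_gf. }
  assert (Heq : exp ((x / 2) ^ 2) * exp_gf c x = / sqrt PI).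
  { apply (eq_of_is_derive (fun y => exp ((y / 2) ^ 2) * exp_gf c y) (fun _ => / sqrt PI) (fun _ => 0)).
    - intros y. change R in y.
      replace 0 with (y / 2 * exp ((y / 2) ^ 2) * exp_gf c y + exp ((y / 2) ^ 2) * - (y / 2 * exp_gf c y)) by ring.
      apply (is_derive_mult (fun y => exp ((y / 2) ^ 2)) (exp_gf c)).
      + auto_derive; trivial. unfold Rdiv. simpl. field.
      + rewrite <- (Hode y). now apply is_derive_exp_gf.
      + intros a b. apply Rmult_comm.
    - intros y. exact (is_derive_const (/ sqrt PI) y).
    - rewrite exp_gf_0. unfold c. simpl INR. replace ((0 / 2) ^ 2) with 0 by field.
      replace (1 - 1 * (1 / 2)) with (/ 2) by field. rewrite exp_0, rgamma_half. ring. }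
  rewrite <- Heq, exp_Ropp. field. apply Rgt_not_eq, exp_pos.
Qed.

(** * The error function *)

Lemma is_derive_erf (x : R) : is_derive erf x (2 / sqrt PI * exp (- x ^ 2)).
Proof.
  apply is_derive_scal with (f := gauss). apply is_derive_gauss.
Qed.

Lemma sqrt_PI_pos : 0 < sqrt PI.
Proof. apply sqrt_lt_R0, PI_RGT_0. Qed.

Lemma erf_0 : erf 0 = 0.
Proof. change (erf 0) with (2 / sqrt PI * gauss 0). rewrite gauss_0. ring. Qed.

Lemma erf_lt (x y : R) : x < y -> erf x < erf y.
Proof.
  intros Hxy. apply Rmult_lt_compat_l; [| now apply (gauss_lt x y)].
  apply Rdiv_lt_0_compat; [lra | apply sqrt_PI_pos].
Qed.

Lemma erf_lim : filterlim erf (Rbar_locally p_infty) (locally 1).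
Proof.
  replace 1 with (2 / sqrt PI * (sqrt PI / 2)) by (field; apply Rgt_not_eq, sqrt_PI_pos).
  apply (filterlim_Rmult (Rbar_locally p_infty)); [apply filterlim_const | apply gauss_lim].
Qed.

Lemma erf_surj (d : R) : 0 < d < 1 -> exists mu, 0 < mu /\ erf mu = d.
Proof.
  intros Hd.
  destruct (proj1 (filterlim_Rabs_locally (Rbar_locally p_infty) _ _) erf_lim (1 - d) ltac:(lra)) as [M HM].
  set (b := Rmax 1 (M + 1)).
  assert (Hb1 : 1 <= b) by apply Rmax_l. assert (HbM : M + 1 <= b) by apply Rmax_r.
  assert (Hb := HM b ltac:(lra)). apply Rabs_def2 in Hb.
  destruct (IVT (fun x => erf x - d) 0 b) as [mu [Hmu Heq]].
  - intros x. apply continuity_pt_filterlim. apply (ex_derive_continuous (fun x => erf x - d)).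
    apply (ex_derive_minus erf (fun _ => d)); [eexists; apply is_derive_erf | apply ex_derive_const].
  - lra.
  - rewrite erf_0. lra.
  - lra.
  - exists mu. split; [| lra]. destruct (proj1 Hmu) as [H | <-]; [exact H |]. rewrite erf_0 in Heq. lra.
Qed.

Lemma Wright_cdf_half (x : R) : Wright_cdf (1 / 2) x = erf (x / 2).
Proof.
  apply (eq_of_is_derive (Wright_cdf (1 / 2)) (fun x => erf (x / 2)) (Mainardi (1 / 2))).
  - intros y. apply is_derive_Wright_cdf. lra.
  - intros y. rewrite Mainardi_half.
    assert (H : is_derive (fun x => x / 2) y (/ 2)) by (auto_derive; trivial; field).
    assert (H1 := is_derive_comp erf (fun x => x / 2) y _ _ (is_derive_erf (y / 2)) H).
    replace (/ sqrt PI * exp (- (y / 2) ^ 2)) with (scal (/ 2) (2 / sqrt PI * exp (- (y / 2) ^ 2))); [exact H1 |].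
    unfold scal; simpl. unfold mult; simpl. field. apply Rgt_not_eq, sqrt_PI_pos.
  - unfold Wright_cdf. rewrite Wright_exp_gf, exp_gf_0. replace (0 / 2) with 0 by field. simpl INR.
    rewrite erf_0, Rmult_0_l, Rminus_0_r, rgamma_1. ring.
Qed.

(** Coefficients and argument move together, as nu and xi_alpha both depend on alpha. Eventually the
    argument stays within 1 of [l], so the majorant at |l| + 1 applies. *)
Lemma exp_gf_lim {T : Type} (F : (T -> Prop) -> Prop) {FF : ProperFilter F}
    (c : T -> nat -> R) (d : nat -> R) (x : T -> R) (l : R) :
  F (fun t => forall n, Rabs (c t n) <= euler_bound (S n)) ->
  (forall n, filterlim (fun t => c t n) F (locally (d n))) ->
  filterlim x F (locally l) ->
  filterlim (fun t => exp_gf (c t) (x t)) F (locally (exp_gf d l)).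
Proof.
  intros Hb Hc Hx. rewrite exp_gf_Series.
  apply filterlim_ext with (fun t => Series (fun n => (- x t) ^ n / INR (fact n) * c t n)).
  { intros t. symmetry. apply exp_gf_Series. }
  apply (tannery F) with (wright_majorant (Rabs l + 1)).
  - apply ex_series_wright_majorant. generalize (Rabs_pos l). lra.
  - generalize (filter_and _ _ Hb (proj1 (filterlim_Rabs_locally F x l) Hx 1 Rlt_0_1)).
    apply filter_imp. intros t [H1 H2] n. apply wright_majorant_le; [| apply H1].
    rewrite Rabs_Ropp. assert (H := Rabs_triang_inv (x t) l). lra.
  - intros n. apply (filterlim_Rmult F); [| apply Hc].
    apply (filterlim_continuous F (fun t => - x t) (fun y => y ^ n / INR (fact n))).
    + now apply (filterlim_Ropp F).
    + apply (ex_derive_continuous (fun y => y ^ n / INR (fact n))). now auto_derive.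
Qed.

Lemma filterlim_rgamma_index {T : Type} (F : (T -> Prop) -> Prop) {FF : Filter F} (nu : T -> R) (n : nat) :
  filterlim nu F (locally (1 / 2)) ->
  filterlim (fun t => rgamma (1 - INR (S n) * nu t)) F (locally (rgamma (1 - INR (S n) * (1 / 2)))).
Proof.
  intros Hnu. apply (filterlim_continuous F (fun t => 1 - INR (S n) * nu t) rgamma).
  - apply (filterlim_Rminus F); [apply filterlim_const |].
    apply (filterlim_Rmult F); [apply filterlim_const | exact Hnu].
  - apply continuous_rgamma. generalize (INR_S_pos n). lra.
Qed.

Lemma Mainardi_lim {T : Type} (F : (T -> Prop) -> Prop) {FF : ProperFilter F} (nu x : T -> R) (l : R) :
  F (fun t => 0 < nu t <= / 2) -> filterlim nu F (locally (1 / 2)) -> filterlim x F (locally l) ->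
  filterlim (fun t => Mainardi (nu t) (x t)) F (locally (Mainardi (1 / 2) l)).
Proof.
  intros Hb Hnu Hx. rewrite Mainardi_exp_gf.
  apply filterlim_ext with (fun t => exp_gf (fun n => rgamma (1 - INR (S n) * nu t)) (x t)).
  { intros t. symmetry. apply Mainardi_exp_gf. }
  apply (exp_gf_lim F (fun t n => rgamma (1 - INR (S n) * nu t))); [| | exact Hx].
  - revert Hb. apply filter_imp. intros t Ht n. now apply rgamma_Mainardi_bound.
  - intros n. now apply (filterlim_rgamma_index F).
Qed.

Lemma Wright_cdf_lim {T : Type} (F : (T -> Prop) -> Prop) {FF : ProperFilter F} (nu x : T -> R) (l : R) :
  F (fun t => 0 < nu t <= / 2) -> filterlim nu F (locally (1 / 2)) -> filterlim x F (locally l) ->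
  filterlim (fun t => Wright_cdf (nu t) (x t)) F (locally (erf (l / 2))).
Proof.
  intros Hb Hnu Hx. rewrite <- Wright_cdf_half.
  apply (filterlim_Rminus F); [apply filterlim_const |]. rewrite Wright_exp_gf.
  apply filterlim_ext with (fun t => exp_gf (fun n => rgamma (1 - INR n * nu t)) (x t)).
  { intros t. symmetry. apply Wright_exp_gf. }
  apply (exp_gf_lim F (fun t n => rgamma (1 - INR n * nu t))); [| | exact Hx].
  - revert Hb. apply filter_imp. intros t Ht n. now apply rgamma_Wright_bound.
  (* The coefficient of index 0 is 1/Gamma(1) for every nu. It is treated as a constant because
     [continuous_rgamma] stops short of the point 1. *)
  - intros [| n]; [| now apply (filterlim_rgamma_index F)].
    simpl INR. apply filterlim_ext with (fun _ => rgamma (1 - 0 * (1 / 2))); [| apply filterlim_const].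
    intros t. f_equal. ring.
Qed.

(* Monotonicity of [Wright_cdf nu] turns the pointwise limit at [l +- eps] into a two-sided bound on the roots. *)
Lemma Wright_cdf_root_lim {T : Type} (F : (T -> Prop) -> Prop) {FF : ProperFilter F} (nu x d : T -> R) (mu : R) :
  F (fun t => 0 < nu t <= / 2) -> filterlim nu F (locally (1 / 2)) ->
  F (fun t => 0 < x t /\ Wright_cdf (nu t) (x t) = d t) ->
  0 < mu -> filterlim d F (locally (erf mu)) ->
  filterlim x F (locally (2 * mu)).
Proof.
  intros Hb Hnu Hx Hmu Hd. apply (filterlim_Rabs_locally F). intros eps He.
  (* Capping by [2 * mu] keeps the left comparison point nonnegative, where monotonicity is
     known. *)
  set (e := Rmin eps (2 * mu)). assert (He0 : 0 < e) by (apply Rmin_glb_lt; lra).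
  assert (He1 : e <= eps) by apply Rmin_l. assert (He2 : e <= 2 * mu) by apply Rmin_r.
  assert (Hlim : forall l, filterlim (fun t => Wright_cdf (nu t) l - d t) F (locally (erf (l / 2) - erf mu))).
  { intros l. apply (filterlim_Rminus F); [| exact Hd].
    apply (Wright_cdf_lim F nu (fun _ => l)); trivial. apply filterlim_const. }
  assert (H1 : erf ((2 * mu - e) / 2) < erf mu) by (apply erf_lt; lra).
  assert (H2 : erf mu < erf ((2 * mu + e) / 2)) by (apply erf_lt; lra).
  assert (L1 := proj1 (filterlim_Rabs_locally F _ _) (Hlim (2 * mu - e)) (erf mu - erf ((2 * mu - e) / 2)) ltac:(lra)).
  assert (L2 := proj1 (filterlim_Rabs_locally F _ _) (Hlim (2 * mu + e)) (erf ((2 * mu + e) / 2) - erf mu) ltac:(lra)).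
  generalize (filter_and _ _ (filter_and _ _ Hb Hx) (filter_and _ _ L1 L2)).
  apply filter_imp. intros t [[Ht [Hxt Heq]] [K1 K2]].
  apply Rabs_def2 in K1. apply Rabs_def2 in K2.
  apply Rabs_def1.
  - apply Rnot_le_lt. intros Hle. assert (H := Wright_cdf_le (nu t) (2 * mu + e) (x t) Ht ltac:(lra) ltac:(lra)). lra.
  - apply Rnot_le_lt. intros Hle. assert (H := Wright_cdf_le (nu t) (x t) (2 * mu - e) Ht ltac:(lra) ltac:(lra)). lra.
Qed.

Lemma continuous_Gamma_unit (x : R) : 0 < x < 1 -> continuous Gamma x.
Proof.
  intros Hx. apply (continuous_ext_loc Gamma (fun y => / rgamma y) x).
  - generalize (open_gt 0 x (proj1 Hx)). apply filter_imp. intros y Hy. now rewrite rgamma_pos, Rinv_inv.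
  - apply (filterlim_Rinv (locally x)); [| apply continuous_rgamma; lra].
    rewrite rgamma_pos by lra. apply Rinv_neq_0_compat, Rgt_not_eq, Gamma_unit_pos. lra.
Qed.

Theorem theorem5 (rho k c Tm T0 q0 : R) (xi : R -> R) :
  0 < rho -> 0 < k -> 0 < c -> Tm < T0 -> 0 < q0 ->
  (T0 - Tm) / q0 * sqrt (rho * c * k / PI) < 1 ->
  (* xi alpha is the (unique) positive solution of the fractional equation,
     whenever 0 < alpha < 1 and the data hypothesis holds for alpha *)
  (forall alpha, 0 < alpha < 1 ->
     sqrt (rho * c * k) * (T0 - Tm) / (q0 * Gamma (1 - alpha / 2)) < 1 ->
     0 < xi alpha /\
     1 - Wright (- xi alpha) (- (alpha / 2)) 1
       = sqrt (rho * c * k) * (T0 - Tm) / (q0 * Gamma (1 - alpha / 2))) ->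
  let lam := sqrt (k / (rho * c)) in
  exists mu1 : R,
    (0 < mu1 /\ erf mu1 = (T0 - Tm) / q0 * sqrt (rho * c * k / PI)) /\
    (forall mu, 0 < mu -> erf mu = (T0 - Tm) / q0 * sqrt (rho * c * k / PI) -> mu = mu1) /\
    filterlim (fun alpha => ell_alpha c T0 Tm alpha (xi alpha)) (at_left 1)
      (locally (ell_one rho k c q0 mu1)) /\
    (forall t, 0 < t ->
       filterlim (fun alpha => s_alpha lam alpha (xi alpha) t) (at_left 1)
         (locally (s_one lam mu1 t))) /\
    (forall x t, 0 <= x -> 0 < t ->
       filterlim (fun alpha => T_alpha lam T0 Tm alpha (xi alpha) x t) (at_left 1)
         (locally (T_one rho k c lam T0 q0 x t))).
Proof.
  intros Hrho Hk Hc HT Hq Hdata Hxi lam.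
  set (d := (T0 - Tm) / q0 * sqrt (rho * c * k / PI)) in *.
  assert (Hrck : 0 < rho * c * k) by (repeat apply Rmult_lt_0_compat; trivial).
  assert (HPI := PI_RGT_0). assert (HsPI := sqrt_PI_pos).
  assert (Hs : 0 < sqrt (rho * c * k)) by (now apply sqrt_lt_R0).
  assert (Hd0 : 0 < d).
  { apply Rmult_lt_0_compat; [apply Rdiv_lt_0_compat; lra |]. apply sqrt_lt_R0, Rdiv_lt_0_compat; trivial. }
  assert (Hd : d = (T0 - Tm) / q0 * (sqrt (rho * c * k) / sqrt PI)).
  { unfold d. rewrite sqrt_div_alt by trivial. reflexivity. }
  destruct (erf_surj d (conj Hd0 Hdata)) as [mu [Hmu Herf]].
  assert (FF : ProperFilter (at_left 1)) by apply at_left_proper_filter.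
  assert (Hid : filterlim (fun alpha : R => alpha) (at_left 1) (locally 1)).
  { apply (filterlim_filter_le_1 (F := locally 1) (G := at_left 1)); [| apply filterlim_id].
    intros P [eps HP]. exists eps. intros y Hy _. now apply HP. }
  assert (Hnu : filterlim (fun alpha => alpha / 2) (at_left 1) (locally (1 / 2))).
  { apply (filterlim_Rmult (at_left 1)); [exact Hid | apply filterlim_const]. }
  assert (Hrange : at_left 1 (fun alpha => 0 < alpha < 1)).
  { exists (mkposreal 1 Rlt_0_1). intros y Hy Hy1. change (Rabs (y - 1) < 1) in Hy. apply Rabs_def2 in Hy. lra. }
  assert (Hrange2 : at_left 1 (fun alpha => 0 < alpha / 2 <= / 2)).
  { revert Hrange. apply filter_imp. intros y Hy. lra. }
  assert (HG : filterlim (fun alpha => Gamma (1 - alpha / 2)) (at_left 1) (locally (sqrt PI))).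
  { rewrite <- Gamma_half. replace (/ 2) with (1 - 1 / 2) by field.
    apply (filterlim_continuous (at_left 1) (fun alpha => 1 - alpha / 2) Gamma).
    - apply (filterlim_Rminus (at_left 1)); [apply filterlim_const | exact Hnu].
    - apply continuous_Gamma_unit. lra. }
  assert (HG' : filterlim (fun alpha => Gamma (1 + alpha / 2)) (at_left 1) (locally (1 / 2 * sqrt PI))).
  { apply filterlim_ext_loc with (fun alpha => alpha / 2 * Gamma (alpha / 2)).
    - revert Hrange. apply filter_imp. intros y Hy. rewrite (Rplus_comm 1), Gamma_succ; lra.
    - apply (filterlim_Rmult (at_left 1)); [exact Hnu |].
      rewrite <- Gamma_half. replace (/ 2) with (1 / 2) by field.
      apply (filterlim_continuous (at_left 1) (fun alpha => alpha / 2) Gamma); [exact Hnu |].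
      apply continuous_Gamma_unit. lra. }
  set (da := fun alpha => sqrt (rho * c * k) * (T0 - Tm) / (q0 * Gamma (1 - alpha / 2))) in *.
  assert (Hda : filterlim da (at_left 1) (locally (erf mu))).
  { rewrite Herf, Hd.
    replace ((T0 - Tm) / q0 * (sqrt (rho * c * k) / sqrt PI)) with
      (sqrt (rho * c * k) * (T0 - Tm) / (q0 * sqrt PI)) by (field; lra).
    apply (filterlim_Rdiv (at_left 1)); [apply Rgt_not_eq; now apply Rmult_lt_0_compat | apply filterlim_const |].
    apply (filterlim_Rmult (at_left 1)); [apply filterlim_const | exact HG]. }
  assert (Hroot : at_left 1 (fun alpha => 0 < xi alpha /\ Wright_cdf (alpha / 2) (xi alpha) = da alpha)).
  (* [Hxi] speaks only of those alpha that satisfy the fractional data condition. As [da] tends to d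
     < 1, a tolerance of 1 - d secures that condition for all alpha close to 1. *)
  { assert (Hlt := proj1 (filterlim_Rabs_locally (at_left 1) _ _) Hda (1 - d) ltac:(lra)).
    generalize (filter_and _ _ Hrange Hlt). apply filter_imp. intros y [H1 H2].
    apply Rabs_def2 in H2. apply Hxi; [exact H1 |]. fold (da y). lra. }
  assert (Hlim := Wright_cdf_root_lim (at_left 1) (fun alpha => alpha / 2) xi da mu Hrange2 Hnu Hroot Hmu Hda).
  assert (HW := Wright_cdf_lim (at_left 1) (fun alpha => alpha / 2) xi (2 * mu) Hrange2 Hnu Hlim).
  replace (2 * mu / 2) with mu in HW by field.
  assert (Hpow : forall t, 0 < t -> filterlim (fun alpha => Rpower t (alpha / 2)) (at_left 1) (locally (sqrt t))).
  { intros t Ht. rewrite <- Rpower_sqrt by trivial. replace (/ 2) with (1 / 2) by field.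
    apply (filterlim_continuous (at_left 1) (fun alpha => alpha / 2) (Rpower t)); [exact Hnu |].
    apply (ex_derive_continuous (Rpower t)). unfold Rpower. now auto_derive. }
  exists mu. split; [now split |]. split; [| split; [| split]].
  - intros m Hm Heq. destruct (Rtotal_order m mu) as [H | [H | H]]; trivial; apply erf_lt in H; lra.
  (* The limit as it comes out termwise, with Gamma(1/2) = sqrt PI and Gamma(3/2) = sqrt PI / 2.
     Substituting the equation for mu eliminates T0 - Tm in favour of q0. *)
  - replace (ell_one rho k c q0 mu) with
      (c * (T0 - Tm) * sqrt PI / (1 / 2 * sqrt PI) * (Mainardi (1 / 2) (2 * mu) / (2 * mu * erf mu))).
    + apply (filterlim_Rmult (at_left 1)).
      * apply (filterlim_Rdiv (at_left 1)); [lra | | exact HG'].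
        apply (filterlim_Rmult (at_left 1)); [apply filterlim_const | exact HG].
      * apply (filterlim_Rdiv (at_left 1)).
        -- rewrite Herf. apply Rgt_not_eq, Rmult_lt_0_compat; lra.
        -- now apply (Mainardi_lim (at_left 1)).
        -- now apply (filterlim_Rmult (at_left 1)).
    + rewrite Mainardi_half, Herf, Hd. replace (2 * mu / 2) with mu by field. unfold ell_one.
      replace (sqrt (c / (rho * k))) with (c / sqrt (rho * c * k)).
      * field. repeat split; lra.
      * assert (Hrk : 0 < rho * k) by (now apply Rmult_lt_0_compat).
        replace (c / (rho * k)) with (c ^ 2 / (rho * c * k)) by (field; lra).
        rewrite sqrt_div_alt by trivial. rewrite sqrt_pow2 by lra. reflexivity.
  - intros t Ht. unfold s_one. replace (2 * lam * mu * sqrt t) with (lam * (2 * mu) * sqrt t) by ring.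
    apply (filterlim_Rmult (at_left 1)); [| now apply Hpow].
    apply (filterlim_Rmult (at_left 1)); [apply filterlim_const | exact Hlim].
  - intros x t Hx Ht.
    assert (Hlam : 0 < lam).
    { apply sqrt_lt_R0, Rdiv_lt_0_compat; trivial. now apply Rmult_lt_0_compat. }
    assert (Hst : 0 < sqrt t) by (now apply sqrt_lt_R0).
    (* By the equation for mu, (T0 - Tm)/erf(mu) is the classical amplitude q0 sqrt(PI/(rho c
       k)). *)
    replace (T_one rho k c lam T0 q0 x t) with
      (T0 - (T0 - Tm) / erf mu * erf (x / (lam * sqrt t) / 2)).
    + apply (filterlim_Rminus (at_left 1)); [apply filterlim_const |].
      apply (filterlim_Rmult (at_left 1)).
      * apply (filterlim_Rdiv (at_left 1)); [lra | apply filterlim_const | exact HW].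
      * apply (Wright_cdf_lim (at_left 1) (fun alpha => alpha / 2) (fun alpha => x / (lam * Rpower t (alpha / 2))));
          trivial.
        apply (filterlim_Rdiv (at_left 1)); [apply Rgt_not_eq; now apply Rmult_lt_0_compat | apply filterlim_const |].
        apply (filterlim_Rmult (at_left 1)); [apply filterlim_const | now apply Hpow].
    + unfold T_one. replace (x / (lam * sqrt t) / 2) with (x / (2 * lam * sqrt t)) by (field; lra).
      rewrite Herf, Hd. f_equal. f_equal. rewrite sqrt_div_alt by trivial. field. lra.
Qed.
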